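(* Let $\pi$ be a probability distribution on a Polish space $\mathcal{X}$ and $P$ a $\pi$-irreducible Markov transition kernel with $\pi P=\pi$. Suppose there exist a Borel set $J\subseteq\mathcal{X}$ with $\pi(J)>0$, a number $\beta>0$ and a probability measure $\nu$ such that $P(x,\cdot)\geq \beta\,\mathbf{1}(x\in J)\,\nu(\cdot)$ for all $x\in\mathcal{X}$. Let $(X_n,\Gamma_n)_{n\ge0}$ be the split chain described in the context, started with $X_0\sim\nu$, with regeneration times $0=T_0<T_1<T_2<\cdots$, cycle lengths $\tau_k=T_k-T_{k-1}$ and block sums $\Xi_k(g)=\sum_{i=T_{k-1}}^{T_k-1} g(X_i)$. Let $f:\mathcal{X}\to\mathbb{R}$ be Borel with $\pi(|f|)<\infty$, $\theta=\pi(f)$, $\bar f=f-\theta$. For a fixed integer $n\ge1$ let $R(n)=\min\{r: T_r\geq n\}$ and $$\hat\theta_{T_{R(n)}}=\frac{1}{T_{R(n)}}\sum_{i=0}^{T_{R(n)}-1} f(X_i).$$ If $\mathbb{E}(\Xi_1(\bar f))^2<\infty$ and $\mathbb{E}\tau_1^2<\infty$, then (i) $\mathbb{E}\,(\hat\theta_{T_{R(n)}}-\theta)^2\leq \frac{\sigma_{\rm as}^2(f)}{n^2}\,\mathbb{E}\,T_{R(n)}$, and (ii) $\mathbb{E}\,T_{R(n)}\leq n+n_0$, where $\sigma_{\rm as}^2(f)=\frac{\mathbb{E}(\Xi_1(\bar f))^2}{\mathbb{E}\tau_1}$ and $n_0=\frac{\mathbb{E}\tau_1^2}{\mathbb{E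}\tau_1}-1$.
   Context: Split chain: given $J,\beta,\nu$ as in the claim, define the residual kernel $Q(x,\cdot)=\frac{P(x,\cdot)-\beta\mathbf{1}(x\in J)\nu(\cdot)}{1-\beta\mathbf{1}(x\in J)}$. The bivariate Markov chain $(X_n,\Gamma_n)$ on $\mathcal{X}\times\{0,1\}$ is defined by: $\Gamma_{n-1}$ depends only on $X_{n-1}$ with $\Pr(\Gamma_{n-1}=1\mid X_{n-1}=x)=\beta\mathbf{1}(x\in J)$; given $\Gamma_{n-1}=1$, $X_n\sim\nu$; given $\Gamma_{n-1}=0$ and $X_{n-1}=x$, $X_n\sim Q(x,\cdot)$. Regeneration times: $T_0=0$ (since $X_0\sim\nu$), $T_1=\min\{n\ge1:\Gamma_{n-1}=1\}$, $T_k=\min\{n>T_{k-1}:\Gamma_{n-1}=1\}$. Throughout, $\Pr$ and $\mathbb{E}$ without subscript refer to the split chain started with $X_0\sim\nu$. *)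

(* Defs.v *)
From HB Require Import structures.
From mathcomp Require Import all_boot all_order all_algebra.
From mathcomp Require Import all_classical all_reals all_analysis.
Set Implicit Arguments. Unset Strict Implicit. Unset Printing Implicit Defensive.
Import Order.TTheory GRing.Theory Num.Theory.
Local Open Scope classical_set_scope.
Local Open Scope ring_scope.
Local Open Scope ereal_scope.

(** Polish space: a complete pseudometric space (the metric is given by the
    type) which is Hausdorff (so the pseudometric is a metric) and separable. *)
Definition polish_space {R : realType} (M : completePseudoMetricType R) : Prop :=
  hausdorff_space M /\ exists D : set M, countable D /\ closure D = setT.

Notation borel_type M := (g_sigma_algebraType (@open M)).

Section Defs.
Context {R : realType}.

Fixpoint kiter {d} {X : measurableType d}
    (P : X -> {measure set X -> \bar R}) (n : nat) (x : X) (A : set X) : \bar R :=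
  match n with
  | 0%N => \d_x A
  | n'.+1 => \int[P x]_y kiter P n' y A
  end.

Definition pi_irreducible {d} {X : measurableType d}
    (pi : set X -> \bar R) (P : X -> {measure set X -> \bar R}) : Prop :=
  forall A, measurable A -> 0 < pi A ->
    forall x, exists n : nat, 0 < kiter P n.+1 x A.

Definition Qres {d} {X : measurableType d}
    (P : X -> {measure set X -> \bar R}) (beta : R) (J : set X)
    (nu : set X -> \bar R) (x : X) (A : set X) : \bar R :=
  (P x A - (beta * \1_J x)%R%:E * nu A) * ((1 - beta * \1_J x)^-1)%R%:E.

Definition cyl {T : Type} {Om : Type} (X : nat -> Om -> T) (G : nat -> Om -> bool)
    (n : nat) (A : nat -> set T) (B : nat -> set bool) : set Om :=
  [set w | forall i, (i < n)%N -> A i (X i w) /\ B i (G i w)].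

(** (X_n, Gamma_n) on (Om, Pr) is the split chain started with X_0 ~ nu:
    - X_0 ~ nu;
    - given the past and X_n, Gamma_n is Bernoulli(beta 1(X_n in J));
    - given the past (including Gamma_n), X_{n+1} ~ nu if Gamma_n = 1 and
      X_{n+1} ~ Q(X_n, .) if Gamma_n = 0.
    The conditional laws are expressed on cylinder events (a pi-system
    generating the natural filtration). *)
Definition is_split_chain {d d'} {X : measurableType d} {Om : measurableType d'}
    (Pr : probability Om R) (Xs : nat -> Om -> X) (G : nat -> Om -> bool)
    (P : X -> {measure set X -> \bar R}) (beta : R) (J : set X)
    (nu : set X -> \bar R) : Prop :=
  [/\ (forall n, measurable_fun setT (Xs n)),
      (forall n, measurable [set w | G n w]),
      (forall A, measurable A -> Pr (Xs 0%N @^-1` A) = nu A),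
      (forall n A B C, (forall i, measurable (A i)) -> measurable C ->
         Pr (cyl Xs G n A B `&` [set w | C (Xs n w) /\ G n w]) =
         \int[Pr]_(w in cyl Xs G n A B `&` Xs n @^-1` C)
            (beta * \1_J (Xs n w))%R%:E) &
      (forall n A B C, (forall i, measurable (A i)) -> measurable C ->
         Pr (cyl Xs G n.+1 A B `&` Xs n.+1 @^-1` C) =
         \int[Pr]_(w in cyl Xs G n.+1 A B)
            (if G n w then nu C else Qres P beta J nu (Xs n w) C))].

Definition next_regen (g : nat -> bool) (m : nat) : option nat :=
  match pselect (exists n, (m < n)%N && g n.-1) with
  | left H => Some (ex_minn H)
  | right _ => None
  end.

Fixpoint regen (g : nat -> bool) (k : nat) : option nat :=
  match k with
  | 0%N => Some 0%N
  | k'.+1 => obind (next_regen g) (regen g k')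
  end.

Definition Tbar (g : nat -> bool) (k : nat) : \bar R :=
  if regen g k is Some t then (t%:R)%:E else +oo.

(** R(n) = min {r : T_r >= n}  (T_r = +oo counts as >= n). *)
Definition Rn (g : nat -> bool) (n : nat) : nat :=
  let p := fun r => if regen g r is Some t then (n <= t)%N else true in
  match pselect (exists r, p r) with
  | left H => ex_minn H
  | right _ => 0%N
  end.

Definition TR (g : nat -> bool) (n : nat) : option nat := regen g (Rn g n).

Definition Xi1 {T Om : Type} (h : T -> R) (Xs : nat -> Om -> T)
    (G : nat -> Om -> bool) (w : Om) : R :=
  if regen (G^~ w) 1 is Some t then (\sum_(i < t) h (Xs i w))%R else 0%R.

Definition theta_hat {T Om : Type} (f : T -> R) (Xs : nat -> Om -> T)
    (G : nat -> Om -> bool) (n : nat) (w : Om) : R :=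
  if TR (G^~ w) n is Some t then ((\sum_(i < t) f (Xs i w)) / t%:R)%R else 0%R.

End Defs.

Definition TRbar {R : realType} (g : nat -> bool) (n : nat) : \bar R :=
  if TR g n is Some t then (t%:R)%:E else +oo.

(* Main.v *)
Require Import Defs.
From HB Require Import structures.
From mathcomp Require Import all_boot all_order all_algebra.
From mathcomp Require Import all_classical all_reals all_analysis.
From mathcomp Require Import measurable_realfun ring lra zify.
Import Order.TTheory GRing.Theory Num.Theory.
Local Open Scope classical_set_scope.
Local Open Scope ring_scope.
Local Open Scope ereal_scope.

(** Write [N_m] for the first renewal time [>= m], so that [tau_1 = N_1] and
    [T_(R(n)) = N_n], and let [u_k] be the probability that [k] is a renewal
    time. Passing from [N_n] to [N_(n+1)] changes something only when [n] is a
    renewal time, and then a cycle independent of the past is appended. Hence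
    [E N_n = E tau * sum_(k < n) u_k], and for the sums [W_n] of [fbar] up to
    [N_n] one has [E W_n^2 <= E Xi_1^2 * sum_(k < n) u_k], the cross term
    vanishing because [E Xi_1 = 0]; (i) follows from [N_n >= n].

    [E Xi_1 (fbar) = 0] is Kac's formula: the occupation measure of a cycle is
    invariant and, once scaled by [beta pi(J)], is dominated by [pi]; the
    difference is an invariant measure that does not charge [J], hence is zero
    by irreducibility.

    For (ii), the overshoot [V_n = N_n - n] has a subadditive expectation [v_n],
    whence [(n + 1) v_n <= 2 sum_(k <= n) v_k], while the same one-step analysis
    gives [E V_n^2 - v_n + 2 sum_(k <= n) v_k = E (tau^2 - tau) sum_(k < n) u_k].
    Together with [v_n^2 <= E V_n^2] this is [v_n <= E tau^2 / E tau - 1]. *)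

Set Implicit Arguments.
Unset Strict Implicit.
Unset Printing Implicit Defensive.

(** * Laws of restricted maps *)

Lemma ge0_integral_mrestr (d : measure_display) (T : measurableType d)
    (R : realType) (m : {measure set T -> \bar R}) (D : set T)
    (mD : measurable D) (f : T -> \bar R) :
  measurable_fun setT f -> (forall x, 0 <= f x) ->
  \int[mrestr m mD]_x f x = \int[m]_(x in D) f x.
Proof.
move=> mf f0.
have mCD : measurable (~` D) by exact: measurableC.
have dD : [disjoint D & ~` D] by exact/disj_setPCl.
rewrite -(setUv D) ge0_integral_setU//; last by rewrite setUv.
rewrite [X in _ + X](_ : _ = 0) ?adde0; last first.
  rewrite (@eq_measure_integral _ _ _ _ mzero) ?integral_measure_zero//.
  by move=> A mA AD; rewrite /= /mrestr/= (disjoints_subset _ _).2// measure0.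
apply: eq_measure_integral => A mA AD.
by rewrite /= /mrestr setIidl.
Qed.

Section law_on.
Context {d d' : measure_display} {T : measurableType d} {Y : measurableType d'}
  {R : realType}.

(** The unnormalised law of [phi] on the event [D]. Carrying the measurability proofs as arguments
    lets the measure structure be inferred. *)
Definition law_on (m : set T -> \bar R) (D : set T) (mD : measurable D)
    (phi : T -> Y) (mphi : measurable_fun setT phi) : set Y -> \bar R :=
  pushforward (mrestr m mD) phi.

HB.instance Definition _ (m : {measure set T -> \bar R}) (D : set T)
    (mD : measurable D) (phi : T -> Y) (mphi : measurable_fun setT phi) :=
  Measure.copy (law_on m mD mphi)
    (measure_function_pushforward__canonical__measure_function_Measure
      (mrestr m mD) mphi).

Let law_on_fin (m : {finite_measure set T -> \bar R}) (D : set T)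
    (mD : measurable D) (phi : T -> Y) (mphi : measurable_fun setT phi) :
  fin_num_fun (law_on m mD mphi).
Proof.
move=> A mA; rewrite /law_on /pushforward /mrestr; apply: fin_num_measure.
by apply: measurableI => //; rewrite -[X in measurable X]setTI; exact: mphi.
Qed.

HB.instance Definition _ (m : {finite_measure set T -> \bar R}) (D : set T)
    (mD : measurable D) (phi : T -> Y) (mphi : measurable_fun setT phi) :=
  Measure_isFinite.Build _ _ _ (law_on m mD mphi) (law_on_fin m mD mphi).

Lemma law_onE (m : {measure set T -> \bar R}) D mD phi mphi A :
  @law_on m D mD phi mphi A = m (phi @^-1` A `&` D).
Proof. by []. Qed.

Lemma ge0_integral_law_on (m : {measure set T -> \bar R}) D mD phi mphi (f : Y -> \bar R) :
  measurable_fun setT f -> (forall y, 0 <= f y) ->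
  \int[@law_on m D mD phi mphi]_y f y = \int[m]_(x in D) f (phi x).
Proof.
move=> mf f0; rewrite ge0_integral_pushforward//.
rewrite preimage_setT ge0_integral_mrestr//; first last.
  by move=> x; exact: f0.
exact: measurableT_comp.
Qed.

End law_on.

(** Both integrals are taken against image laws, and these are proportional. This turns identities
    between probabilities of events into identities between conditional laws integrated over the
    past. *)
Lemma ge0_integral_eq_law {d1 d2 d' : measure_display} {T1 : measurableType d1}
    {T2 : measurableType d2} {Y : measurableType d'} {R : realType}
    (m1 : {measure set T1 -> \bar R}) (m2 : {measure set T2 -> \bar R})
    (D1 : set T1) (D2 : set T2) (phi1 : T1 -> Y) (phi2 : T2 -> Y) (c : R)
    (f : Y -> \bar R) :
  measurable D1 -> measurable D2 ->
  measurable_fun setT phi1 -> measurable_fun setT phi2 -> (0 <= c)%R ->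
  (forall A, measurable A ->
    m1 (D1 `&` phi1 @^-1` A) = c%:E * m2 (D2 `&` phi2 @^-1` A)) ->
  measurable_fun setT f -> (forall y, 0 <= f y) ->
  \int[m1]_(x in D1) f (phi1 x) = c%:E * \int[m2]_(x in D2) f (phi2 x).
Proof.
move=> mD1 mD2 mphi1 mphi2 c0 H mf f0.
rewrite -(ge0_integral_law_on m1 mD1 mphi1)//.
rewrite -(ge0_integral_law_on m2 mD2 mphi2)//.
rewrite -[c]/((NngNum c0)%:num) -ge0_integral_mscale//.
apply: eq_measure_integral => A mA _.
by rewrite /= /mscale /law_on /pushforward /mrestr/= setIC H// setIC.
Qed.

(** Uniqueness of finite measures on a generating pi-system; [G setT] makes the constant sequence
    [setT] exhausting. *)
Lemma eq_law_gen {d1 d2 d' : measure_display} {T1 : measurableType d1}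
    {T2 : measurableType d2} {Y : measurableType d'} {R : realType}
    (G : set (set Y))
    (m1 : {measure set T1 -> \bar R}) (m2 : {measure set T2 -> \bar R})
    (D1 : set T1) (D2 : set T2) (phi1 : T1 -> Y) (phi2 : T2 -> Y) (c : R) :
  (measurable : set (set Y)) = <<s G >> -> setI_closed G -> G setT ->
  measurable D1 -> measurable D2 ->
  measurable_fun setT phi1 -> measurable_fun setT phi2 -> (0 <= c)%R ->
  m1 D1 < +oo ->
  (forall A, G A ->
    m1 (D1 `&` phi1 @^-1` A) = c%:E * m2 (D2 `&` phi2 @^-1` A)) ->
  forall A, measurable A ->
    m1 (D1 `&` phi1 @^-1` A) = c%:E * m2 (D2 `&` phi2 @^-1` A).
Proof.
move=> mG GI GT mD1 mD2 mphi1 mphi2 c0 D1oo H A mA.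
have -> : m1 (D1 `&` phi1 @^-1` A) = law_on m1 mD1 mphi1 A.
  by rewrite law_onE setIC.
have -> : m2 (D2 `&` phi2 @^-1` A) = law_on m2 mD2 mphi2 A.
  by rewrite law_onE setIC.
apply: (@measure_unique _ R _ G (fun=> setT) mG GI (fun=> GT) _
  (law_on m1 mD1 mphi1) (mscale (NngNum c0) (law_on m2 mD2 mphi2))) => //.
- by rewrite bigcup_const.
- by move=> B GB; rewrite /= /law_on /pushforward /mrestr/= setIC H// setIC.
- by move=> _; rewrite /= /law_on /pushforward /mrestr preimage_setT setTI.
Qed.

(** * Path space *)

Definition cylinder {T : Type} (n : nat) (A : nat -> set T) (B : nat -> set bool)
    : set (nat -> T * bool) :=
  [set p | forall i, (i < n)%N -> A i (p i).1 /\ B i (p i).2].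

(** [N] is the set of admissible lengths, so that the whole path ([N = setT]) and the past of a
    fixed time ([N = [set n]]) share one theory. *)
Definition cylinders {d : measure_display} (T : measurableType d) (N : set nat)
    : set (set (nat -> T * bool)) :=
  [set C | exists n A B,
    [/\ N n, (forall i, measurable (A i)) & C = cylinder n A B]].
Arguments cylinders {d} T N _ : assert.

Lemma setI_cylinder {T : Type} n1 A1 B1 n2 A2 B2 :
  @cylinder T n1 A1 B1 `&` cylinder n2 A2 B2 =
  cylinder (maxn n1 n2)
    (fun i => (if (i < n1)%N then A1 i else setT) `&`
              (if (i < n2)%N then A2 i else setT))
    (fun i => (if (i < n1)%N then B1 i else setT) `&`
              (if (i < n2)%N then B2 i else setT)).
Proof.
apply/seteqP; split=> p /=.
  move=> [p1 p2] i _; split; split; case: ifPn => // ni.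
  - by have [] := p1 i ni.
  - by have [] := p2 i ni.
  - by have [] := p1 i ni.
  - by have [] := p2 i ni.
move=> H; split=> i ni.
  have /H : (i < maxn n1 n2)%N by rewrite leq_max ni.
  by rewrite ni => -[[? _] [? _]].
have /H : (i < maxn n1 n2)%N by rewrite leq_max ni orbT.
by rewrite ni => -[[_ ?] [_ ?]].
Qed.

Section paths.
Context {d : measure_display} (T : measurableType d).

Lemma setI_closed_cylinders (N : set nat) :
  (forall m n, N m -> N n -> N (maxn m n)) -> setI_closed (cylinders T N).
Proof.
move=> HN _ _ [n1 [A1 [B1 [N1 mA1 ->]]]] [n2 [A2 [B2 [N2 mA2 ->]]]].
rewrite setI_cylinder; do 3 eexists; split; last reflexivity; first exact: HN.
by move=> i; apply: measurableI; case: ifP.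
Qed.

Lemma cylindersT (N : set nat) n : N n -> cylinders T N setT.
Proof.
move=> Nn; exists n, (fun=> setT), (fun=> setT); split => //.
by apply/seteqP; split.
Qed.

(** Both spaces have the same carrier; the second one only sees the first [n]
    coordinates. *)
Definition path_space := g_sigma_algebraType (cylinders T setT).
Definition past_space (n : nat) := g_sigma_algebraType (cylinders T [set n]).

HB.instance Definition _ := Measurable.on path_space.
HB.instance Definition _ n := Measurable.on (past_space n).

Lemma measurable_coord (N : set nat) n i (A : set T) (B : set bool) : N n ->
  (i < n)%N -> measurable A ->
  measurable ([set p | A (p i).1 /\ B (p i).2]
    : set (g_sigma_algebraType (cylinders T N))).
Proof.
move=> Nn lin mA; apply: sub_sigma_algebra.
exists n, (fun j => if j == i then A else setT),
  (fun j => if j == i then B else setT); split => //; first by move=> j; case: ifP.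
apply/seteqP; split=> p /=.
  by move=> [pA pB] j jn; case: eqP => [->|].
by move=> /(_ i lin); rewrite eqxx.
Qed.

Lemma measurable_fst_coord (N : set nat) n i : N n -> (i < n)%N ->
  measurable_fun setT
   (fun p : g_sigma_algebraType (cylinders T N) => (p i).1).
Proof.
move=> Nn lin _ A mA; rewrite setTI.
have := @measurable_coord N n i A setT Nn lin mA.
by congr (measurable _); apply/seteqP; split=> p //= [].
Qed.

Lemma measurable_snd_coord (N : set nat) n i : N n -> (i < n)%N ->
  measurable_fun setT
   (fun p : g_sigma_algebraType (cylinders T N) => (p i).2).
Proof.
move=> Nn lin _ B mB; rewrite setTI.
have := @measurable_coord N n i setT B Nn lin measurableT.
by congr (measurable _); apply/seteqP; split=> p //= [].
Qed.

End paths.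

Definition traj {T Om : Type} (X : nat -> Om -> T) (G : nat -> Om -> bool)
    (k : nat) (w : Om) : nat -> T * bool :=
  fun i => (X (k + i)%N w, G (k + i)%N w).

Section measurable_traj.
Context {d d' : measure_display} {T : measurableType d} {Om : measurableType d'}.
Variables (X : nat -> Om -> T) (G : nat -> Om -> bool).
Hypothesis mX : forall n, measurable_fun setT (X n).
Hypothesis mG : forall n, measurable [set w | G n w].

Lemma measurable_funG n : measurable_fun setT (G n).
Proof. by apply: (@measurable_fun_bool _ _ _ _ true); rewrite setTI; exact: mG. Qed.

Lemma cylE n A B : cyl X G n A B = traj X G 0 @^-1` cylinder n A B.
Proof. by []. Qed.

Lemma measurable_traj_cylinder k n A B : (forall i, measurable (A i)) ->
  measurable (traj X G k @^-1` cylinder n A B).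
Proof.
move=> mA.
rewrite (_ : _ @^-1` _ = \bigcap_(i in [set j | (j < n)%N])
   (X (k + i)%N @^-1` A i `&` G (k + i)%N @^-1` B i)); last first.
  by apply/seteqP; split=> w.
apply: bigcap_measurableType => i _.
apply: measurableI; rewrite -[X in measurable X]setTI.
- exact: mX.
- exact: measurable_funG.
Qed.

Lemma measurable_traj (N : set nat) k :
  measurable_fun setT (traj X G k : Om -> g_sigma_algebraType (cylinders T N)).
Proof.
pose PT := g_sigma_algebraType (cylinders T N).
refine (@measurability _ _ Om PT setT (traj X G k) (cylinders T N) _ _) => //.
move=> _ [_ [n [A [B [_ mA ->]]]] <-]; rewrite setTI.
exact: measurable_traj_cylinder.
Qed.

End measurable_traj.

(** * Regeneration of the split chain *)

Section split_chain.
Context {d d' : measure_display} {T : measurableType d} {Om : measurableType d'}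
  {R : realType}.
Variables (P : R.-pker T ~> T) (J : set T) (beta : R) (nu : probability T R).
Hypotheses (mJ : measurable J) (beta_gt0 : (0 < beta)%R).
Hypothesis Hminor : forall x A, measurable A ->
  (beta * \1_J x)%R%:E * nu A <= P x A.
Variables (Pr : probability Om R) (Xs : nat -> Om -> T) (G : nat -> Om -> bool).
Hypothesis Hsplit : is_split_chain Pr Xs G P beta J nu.

Let mX n : measurable_fun setT (Xs n). Proof. by case: Hsplit. Qed.
Let mG n : measurable [set w | G n w]. Proof. by case: Hsplit. Qed.

Let b x := (beta * \1_J x)%R.

Lemma minor_weight_ge0 x : (0 <= b x)%R.
Proof. by rewrite /b mulr_ge0 ?(ltW beta_gt0)// indicE. Qed.

Lemma minor_weight_le1 x : (b x <= 1)%R.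
Proof.
have := Hminor x measurableT; rewrite probability_setT mule1.
by rewrite prob_kernel lee_fin.
Qed.

Lemma measurable_minor_weight : measurable_fun setT (fun x => (b x)%:E).
Proof.
apply/measurable_EFinP; apply: measurable_funM => //.
Qed.

Lemma Qres_ge0 x A : measurable A -> 0 <= Qres P beta J nu x A.
Proof.
move=> mA; rewrite /Qres mule_ge0//.
  rewrite sube_ge0; first exact: Hminor.
  by rewrite fin_numM ?fin_num_measure.
by rewrite lee_fin invr_ge0 subr_ge0 minor_weight_le1.
Qed.

Lemma measurable_Qres A : measurable A ->
  measurable_fun setT (fun x => Qres P beta J nu x A).
Proof.
move=> mA; apply: emeasurable_funM.
  apply: emeasurable_funB; first exact: measurable_kernel.
  by apply: emeasurable_funM => //; exact: measurable_minor_weight.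
apply/measurable_EFinP.
(* The normalising factor takes only the values [(1 - beta)^-1] and [1], so it is affine in [\1_J];
   with [0^-1 = 0] this covers [beta = 1] too. *)
rewrite (_ : (fun x => _) =
    (fun x => 1 + ((1 - beta)^-1 - 1) * \1_J x)%R); last first.
  apply/funext => x; rewrite indicE; case: (x \in J).
    by rewrite !mulr1 [RHS]addrC subrK.
  by rewrite !mulr0 subr0 invr1 addr0.
by apply: measurable_funD => //; exact: measurable_funM.
Qed.

Lemma traj_cat k n A B A' B' :
  traj Xs G 0 @^-1` cylinder k A B `&` traj Xs G k @^-1` cylinder n A' B' =
  cyl Xs G (k + n) (fun i => if (i < k)%N then A i else A' (i - k)%N)
    (fun i => if (i < k)%N then B i else B' (i - k)%N).
Proof.
apply/seteqP; split=> w /=.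
  move=> [H1 H2] i ikn; case: ltnP => ik; first exact: H1.
  by have := H2 (i - k)%N; rewrite /traj subnKC//; apply; rewrite ltn_subLR.
move=> H; split=> i ni.
  by have := H i; rewrite ni; apply; rewrite ltn_addr.
have ki : (k + i < k)%N = false by rewrite ltnNge leq_addr.
by have := H (k + i)%N; rewrite ltn_add2l addKn ki; apply.
Qed.

Let mZ n : measurable_fun setT (fun w => (Xs n w, G n w)).
Proof. by apply: measurable_fun_pair => //; exact: measurable_funG. Qed.

Let mcyl n A B : (forall i, measurable (A i)) -> measurable (cyl Xs G n A B).
Proof. by move=> mA; rewrite cylE; apply: measurable_traj_cylinder. Qed.

Let mXp n C : measurable C -> measurable (Xs n @^-1` C).
Proof. by move=> mC; rewrite -[X in measurable X]setTI; exact: mX. Qed.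

Let mXG n C : measurable C -> measurable [set w | C (Xs n w) /\ G n w].
Proof. by move=> mC; apply: measurableI; [exact: mXp|exact: mG]. Qed.

Let mXGN n C : measurable C -> measurable [set w | C (Xs n w) /\ ~~ G n w].
Proof.
move=> mC; apply: measurableI; first exact: mXp.
rewrite (_ : (fun w => _) = ~` [set w | G n w]); first exact: measurableC.
by apply/seteqP; split=> w /= /negP.
Qed.

Lemma Pr_GammaN n E C : measurable E -> measurable C ->
  Pr (E `&` [set w | C (Xs n w) /\ ~~ G n w]) =
  Pr (E `&` Xs n @^-1` C) - Pr (E `&` [set w | C (Xs n w) /\ G n w]).
Proof.
move=> mE mC.
have -> : E `&` [set w | C (Xs n w) /\ ~~ G n w] =
    (E `&` Xs n @^-1` C) `\` (E `&` [set w | C (Xs n w) /\ G n w]).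
  apply/seteqP; split=> w /=.
    by move=> [Ew [Cw /negP Gw]]; split=> // -[_ []].
  by move=> [[Ew Cw] nG]; split=> //; split=> //; apply/negP => Gw; apply: nG.
rewrite measureD//.
- congr (_ - Pr _); apply/seteqP; split=> w /=; first by case.
  by move=> [Ew [Cw Gw]].
- by apply: measurableI => //; exact: mXp.
- by apply: measurableI => //; exact: mXG.
- apply: (le_lt_trans (probability_le1 _ _)); last exact: ltry.
  by apply: measurableI => //; exact: mXp.
Qed.

Lemma measurable_section_bool (D : set (T * bool)) bb : measurable D ->
  measurable [set x | D (x, bb)].
Proof.
move=> /(measurable_ysection bb); congr (measurable _).
by apply/seteqP; split=> x; rewrite /ysection/= inE.
Qed.

Lemma Pr_Gamma_split n E D : measurable E -> measurable D ->
  Pr (E `&` (fun w => (Xs n w, G n w)) @^-1` D) =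
  Pr (E `&` [set w | [set x | D (x, true)] (Xs n w) /\ G n w]) +
  Pr (E `&` [set w | [set x | D (x, false)] (Xs n w) /\ ~~ G n w]).
Proof.
move=> mE mD.
have mDt : measurable [set x | D (x, true)] by exact: measurable_section_bool.
have mDf : measurable [set x | D (x, false)] by exact: measurable_section_bool.
rewrite -measureU//.
- congr (Pr _); apply/seteqP; split=> w /=.
    by case: (G n w) => -[Ew Dw]; [left|right].
  by case: (G n w) => -[[Ew []]|[Ew []]].
- by apply: measurableI => //; exact: mXG.
- by apply: measurableI => //; exact: mXGN.
- by apply/seteqP; split=> w //= [[_ [_ Gw]]] [_ [_ /negP]].
Qed.

Section transfer.
Variables (n1 n2 : nat) (A1 A2 : nat -> set T) (B1 B2 : nat -> set bool) (c : R).
Hypotheses (mA1 : forall i, measurable (A1 i)) (mA2 : forall i, measurable (A2 i)).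
Hypothesis c0 : (0 <= c)%R.
Let E1 := cyl Xs G n1 A1 B1.
Let E2 := cyl Xs G n2 A2 B2.

(** The conditional law of [G n] given the past is the same function of [Xs n] at every time, so
    proportionality of the laws of the state on two cylinders passes to the pairs. *)
Lemma transfer_Gamma :
  (forall C, measurable C ->
    Pr (E1 `&` Xs n1 @^-1` C) = c%:E * Pr (E2 `&` Xs n2 @^-1` C)) ->
  forall D, measurable D ->
    Pr (E1 `&` (fun w => (Xs n1 w, G n1 w)) @^-1` D) =
    c%:E * Pr (E2 `&` (fun w => (Xs n2 w, G n2 w)) @^-1` D).
Proof.
move=> H.
have HT C : measurable C ->
    Pr (E1 `&` [set w | C (Xs n1 w) /\ G n1 w]) =
    c%:E * Pr (E2 `&` [set w | C (Xs n2 w) /\ G n2 w]).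
  move=> mC; case: Hsplit => _ _ _ HG _; rewrite !HG//.
  apply: (ge0_integral_eq_law (f := fun x => (b x)%:E)) => //.
  - by apply: measurableI; [exact: mcyl|exact: mXp].
  - by apply: measurableI; [exact: mcyl|exact: mXp].
  - by move=> A mA; rewrite -!setIA; exact: (H _ (measurableI _ _ mC mA)).
  - exact: measurable_minor_weight.
  - by move=> x; rewrite lee_fin minor_weight_ge0.
have HF C : measurable C ->
    Pr (E1 `&` [set w | C (Xs n1 w) /\ ~~ G n1 w]) =
    c%:E * Pr (E2 `&` [set w | C (Xs n2 w) /\ ~~ G n2 w]).
  move=> mC; rewrite !Pr_GammaN//; try exact: mcyl.
  rewrite H// HT// muleBr// fin_num_adde_defl// fin_numN fin_num_measure//.
  by apply: measurableI; [exact: mcyl|exact: mXG].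
move=> D mD; rewrite !Pr_Gamma_split//; try exact: mcyl.
have mDt : measurable [set x | D (x, true)] by exact: measurable_section_bool.
have mDf : measurable [set x | D (x, false)] by exact: measurable_section_bool.
by rewrite HT// HF// ge0_muleDr.
Qed.

(** Likewise the conditional law of the next state depends on the past only through the current
    pair. The longer cylinders come with equations because callers describe their coordinates in
    different ways. *)
Lemma transfer_X A B : measurable A ->
  (forall D, measurable D ->
    Pr (E1 `&` (fun w => (Xs n1 w, G n1 w)) @^-1` D) =
    c%:E * Pr (E2 `&` (fun w => (Xs n2 w, G n2 w)) @^-1` D)) ->
  forall A1' B1' A2' B2',
  (forall i, measurable (A1' i)) -> (forall i, measurable (A2' i)) ->
  cyl Xs G n1.+1 A1' B1' = E1 `&` [set w | A (Xs n1 w) /\ B (G n1 w)] ->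
  cyl Xs G n2.+1 A2' B2' = E2 `&` [set w | A (Xs n2 w) /\ B (G n2 w)] ->
  forall C, measurable C ->
    Pr (cyl Xs G n1.+1 A1' B1' `&` Xs n1.+1 @^-1` C) =
    c%:E * Pr (cyl Xs G n2.+1 A2' B2' `&` Xs n2.+1 @^-1` C).
Proof.
move=> mA H A1' B1' A2' B2' mA1' mA2' H1 H2 C mC.
case: Hsplit => _ _ _ _ HX; rewrite !HX//.
apply: (ge0_integral_eq_law (phi1 := fun w => (Xs n1 w, G n1 w))
  (phi2 := fun w => (Xs n2 w, G n2 w))
  (f := fun z => if z.2 then nu C else Qres P beta J nu z.1 C)) => //.
- exact: mcyl.
- exact: mcyl.
- move=> D mD; rewrite H1 H2.
  have mAB : measurable ((A `*` B) : set (T * bool)) by exact: measurableX.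
  by have := H _ (measurableI _ _ mAB mD); rewrite !preimage_setI !setIA.
- apply: measurable_fun_ifT => //.
  by apply: (measurableT_comp (measurable_Qres _)).
- by move=> [x []]//=; exact: Qres_ge0.
Qed.

End transfer.

(** The inclusion forces [G s] to be true, so the state at time [s.+1] has law [nu] whatever the
    past: this is the case [n = 0]. The two transfer lemmas then carry the factor [Pr E] forward one
    step at a time. *)
Lemma regen_cylinder s n A B A' B' : B s `<=` [set true] ->
  (forall i, measurable (A i)) -> (forall i, measurable (A' i)) ->
  forall C, measurable C ->
  Pr (traj Xs G 0 @^-1` cylinder s.+1 A B `&`
      traj Xs G s.+1 @^-1` cylinder n A' B' `&` Xs (s.+1 + n)%N @^-1` C) =
  Pr (traj Xs G 0 @^-1` cylinder s.+1 A B) *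
  Pr (traj Xs G 0 @^-1` cylinder n A' B' `&` Xs n @^-1` C).
Proof.
move=> Bs mA mA'.
set E := traj Xs G 0 @^-1` cylinder s.+1 A B.
have mE : measurable E by exact: mcyl.
have PrE : (fine (Pr E))%:E = Pr E by rewrite fineK// fin_num_measure.
have PrE0 : (0 <= fine (Pr E))%R by exact: fine_ge0.
have mAcat m i : measurable
    ((fun i => if (i < m)%N then A i else A' (i - m)%N) i).
  by case: ifP.
elim: n => [|n IH] C mC.
  have cyl0 k : traj Xs G k @^-1` cylinder 0 A' B' = setT.
    by apply/seteqP; split.
  rewrite !cyl0 setIT setTI addn0.
  case: Hsplit => _ _ -> // _ HX; rewrite HX//.
  rewrite (eq_integral (fun=> nu C)).
    by rewrite integral_cst// muleC.
  move=> w /set_mem /(_ s (ltnSn s)) [_ /Bs]/=.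
  by move=> ->.
rewrite -PrE traj_cat addnS.
apply: (@transfer_X (s.+1 + n) n
  (fun i => if (i < s.+1)%N then A i else A' (i - s.+1)%N) A'
  (fun i => if (i < s.+1)%N then B i else B' (i - s.+1)%N) B'
  _ PrE0 (A' n) (B' n)) => //.
- apply: transfer_Gamma => //.
  by move=> C' mC'; rewrite PrE -traj_cat IH.
- rewrite -addnS -!traj_cat -setIA; congr (_ `&` _).
  apply/seteqP; split=> w /=.
    by move=> H; split; [move=> i ni; apply: H; exact: ltnW|exact: H].
  by move=> [H1 H2] i; rewrite ltnS leq_eqVlt => /predU1P[->//|]; exact: H1.
- apply/seteqP; split=> w /=.
    by move=> H; split; [move=> i ni; apply: H; exact: ltnW|exact: H].
  by move=> [H1 H2] i; rewrite ltnS leq_eqVlt => /predU1P[->//|]; exact: H1.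
Qed.

Let mtraj N k : measurable_fun setT
  (traj Xs G k : Om -> g_sigma_algebraType (cylinders T N)).
Proof. exact: measurable_traj. Qed.

(** Two extensions from cylinders: first in [D] with [H] fixed, then in [H] with [D] a fixed
    cylinder. *)
Lemma regen_indep s (D : set (past_space T s.+1)) (H : set (path_space T)) :
  measurable D -> measurable H ->
  Pr ([set w | G s w] `&` traj Xs G 0 @^-1` D `&` traj Xs G s.+1 @^-1` H) =
  Pr ([set w | G s w] `&` traj Xs G 0 @^-1` D) * Pr (traj Xs G 0 @^-1` H).
Proof.
move=> mD mH.
have mpath k (K : set (path_space T)) : measurable K -> measurable (traj Xs G k @^-1` K).
  by move=> mK; rewrite -[X in measurable X]setTI; apply: (@mtraj setT k).
have PrH : (fine (Pr (traj Xs G 0 @^-1` H)))%:E = Pr (traj Xs G 0 @^-1` H).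
  by rewrite fineK// fin_num_measure//; exact: mpath.
rewrite setIAC muleC -PrH.
refine (@eq_law_gen _ _ _ Om Om (past_space T s.+1) R (cylinders T [set s.+1])
  Pr Pr ([set w | G s w] `&` traj Xs G s.+1 @^-1` H) [set w | G s w]
  (traj Xs G 0) (traj Xs G 0) (fine (Pr (traj Xs G 0 @^-1` H)))
  _ _ _ _ _ _ _ _ _ _ D mD) => //.
- by apply: setI_closed_cylinders => m n -> ->; rewrite maxnn.
- exact: cylindersT.
- by apply: measurableI => //; exact: mpath.
- exact: fine_ge0.
- apply: (le_lt_trans (probability_le1 _ _)); last exact: ltry.
  by apply: measurableI => //; exact: mpath.
move=> _ [_ [A [B [-> mA ->]]]].
rewrite PrH muleC setIAC.
(* The event [G s] is absorbed into the last coordinate of the cylinder, which is the form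
   [regen_cylinder] takes. *)
pose B' i := if i == s then B i `&` [set true] else B i.
have -> : [set w | G s w] `&` traj Xs G 0 @^-1` cylinder s.+1 A B =
    traj Xs G 0 @^-1` cylinder s.+1 A B'.
  apply/seteqP; split=> w /=.
    move=> [Gs Hc] i si; have [HA HB] := Hc i si; split=> //.
    by rewrite /B'; case: eqP => // is_; split=> //=; rewrite is_.
  move=> Hc; split; first by have [_] := Hc s (ltnSn s); rewrite /B' eqxx => -[].
  move=> i si; have [HA HB] := Hc i si; split=> //.
  by move: HB; rewrite /B'; case: eqP => // _ [].
set E := traj Xs G 0 @^-1` _.
have mE : measurable E by exact: mcyl.
have PrE : (fine (Pr E))%:E = Pr E by rewrite fineK// fin_num_measure.
transitivity ((fine (Pr E))%:E * Pr (setT `&` traj Xs G 0 @^-1` H)); last first.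
  by rewrite setTI PrE.
refine (@eq_law_gen _ _ _ Om Om (path_space T) R (cylinders T setT)
  Pr Pr E setT (traj Xs G s.+1) (traj Xs G 0) (fine (Pr E))
  _ _ _ _ _ _ _ _ _ _ H mH) => //.
- exact: setI_closed_cylinders.
- exact: (@cylindersT _ _ _ 0%N).
- exact: fine_ge0.
- by apply: (le_lt_trans (probability_le1 _ _)); last exact: ltry.
move=> _ [n [A' [B'' [_ mA' ->]]]].
have := @regen_cylinder s n A B' A' B'' _ mA mA' setT measurableT.
rewrite !preimage_setT !setIT PrE setTI; apply.
by rewrite /B' eqxx => ? [].
Qed.

End split_chain.

(** * Renewal times along a path *)

(** Time [0] counts because the chain starts from [nu]. *)
Definition renewal (g : nat -> bool) (s : nat) : bool := (s == 0%N) || g s.-1.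

(** This is [N_m]. Since [next_regen] searches strictly after its argument, it is called at the
    predecessor of [m]. *)
Definition first_renewal (g : nat -> bool) (m : nat) : option nat :=
  if m is k.+1 then next_regen g k else Some 0%N.

Definition shift (k : nat) (g : nat -> bool) : nat -> bool := fun i => g (k + i)%N.

Section first_renewal.
Implicit Types (g : nat -> bool) (m n s : nat).

Lemma first_renewalP g m s : first_renewal g m = Some s <->
  [/\ (m <= s)%N, renewal g s & forall j, (m <= j < s)%N -> ~~ renewal g j].
Proof.
case: m => [|m] /=.
  split=> [[<-]|]; first by split.
  by case: s => [//|s [_ _ /(_ 0%N isT)]].
rewrite /next_regen; case: pselect => [ex|nex]; last first.
  split=> // -[ms rs _]; case: nex; exists s; rewrite ms.
  by case: s rs ms.
case: ex_minnP => r /andP[mr gr] rmin; split=> [[<-]|[ms rs smin]].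
  split => //; first by rewrite /renewal gr orbT.
  move=> j /andP[mj jr]; apply/negP => rj.
  have : (r <= j)%N by apply: rmin; rewrite mj; case: j rj mj {jr}.
  by rewrite leqNgt jr.
congr Some; apply/eqP; rewrite eqn_leq rmin/=; last first.
  by rewrite ms; case: s rs ms {smin}.
rewrite leqNgt; apply/negP => rs'.
by have := smin r; rewrite mr rs' /renewal gr orbT => /(_ isT).
Qed.

Lemma first_renewal_None g m : first_renewal g m = None <->
  forall s, (m <= s)%N -> ~~ renewal g s.
Proof.
split=> [mN s ms|H].
  apply/negP => rs.
  have ex : exists s, (m <= s)%N && renewal g s by exists s; rewrite ms.
  case: (ex_minnP ex) => r /andP[mr rr] rmin.
  have : first_renewal g m = Some r.
    apply/first_renewalP; split => // j /andP[mj jr]; apply/negP => rj.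
    by have := rmin j; rewrite mj rj leqNgt jr => /(_ isT).
  by rewrite mN.
case E : (first_renewal g m) => [s|//].
by move/first_renewalP : E => [ms rs _]; have := H _ ms; rewrite rs.
Qed.

Lemma first_renewal_eq g m n :
  (forall s, (m <= s)%N && renewal g s = (n <= s)%N && renewal g s) ->
  first_renewal g m = first_renewal g n.
Proof.
move=> H; case E : (first_renewal g m) => [s|]; symmetry; last first.
  apply/first_renewal_None => s ns; apply/negP => rs.
  have := H s; rewrite ns rs/= => /andP[ms _].
  by move/first_renewal_None : E => /(_ _ ms); rewrite rs.
move/first_renewalP : E => [ms rs smin]; apply/first_renewalP.
have := H s; rewrite ms rs !andbT => /esym ns; split=> // j /andP[nj js].
apply/negP => rj; have := H j; rewrite nj rj !andbT => mj.
by have := smin j; rewrite mj js rj => /(_ isT).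
Qed.

Lemma first_renewal_le g m s : renewal g s -> (m <= s)%N ->
  exists2 r, first_renewal g m = Some r & (r <= s)%N.
Proof.
move=> rs ms; case E : (first_renewal g m) => [r|]; last first.
  by move/first_renewal_None : E => /(_ _ ms); rewrite rs.
exists r => //; move/first_renewalP : E => [mr _ rmin].
by rewrite leqNgt; apply/negP => sr; have := rmin s; rewrite ms sr rs => /(_ isT).
Qed.

(** The hypothesis matches the convention that time [0] is a renewal of the shifted path. *)
Lemma renewal_shift g n r : renewal g n -> renewal (shift n g) r = renewal g (n + r).
Proof.
by case: r => [|r] rn; rewrite ?addn0 ?rn// /renewal /shift/= addnS.
Qed.

Lemma first_renewal_id g n : renewal g n -> first_renewal g n = Some n.
Proof.
move=> rn; apply/first_renewalP; split=> // j /andP[nj jn].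
by move: nj; rewrite leqNgt jn.
Qed.

Lemma first_renewalS g n : ~~ renewal g n ->
  first_renewal g n.+1 = first_renewal g n.
Proof.
move=> rn; apply: first_renewal_eq => s; rewrite [in RHS]leq_eqVlt.
by case: eqP => [<-|//]; rewrite ltnn (negbTE rn).
Qed.

Lemma first_renewal_shift g n m : renewal g n ->
  first_renewal g (n + m) = omap (addn n) (first_renewal (shift n g) m).
Proof.
move=> rn; case E : (first_renewal (shift n g) m) => [s|] /=; last first.
  apply/first_renewal_None => s nms.
  move/first_renewal_None : E => /(_ (s - n)%N).
  by rewrite renewal_shift// subnKC; [apply; lia|lia].
move/first_renewalP : E => [ms rs smin]; apply/first_renewalP.
rewrite -renewal_shift//; split=> //; first by rewrite leq_add2l.
move=> j /andP[nmj jns]; have := smin (j - n)%N.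
by rewrite renewal_shift// subnKC; [apply; lia|lia].
Qed.

Lemma first_renewal_ge g m s n : first_renewal g m = Some s ->
  (m <= n <= s)%N -> first_renewal g n = Some s.
Proof.
move=> /first_renewalP[ms rs smin] /andP[mn ns]; apply/first_renewalP.
by split=> // j /andP[nj js]; apply: smin; rewrite js (leq_trans mn).
Qed.

Lemma regen_ge g r t : regen g r = Some t -> (r <= t)%N.
Proof.
elim: r t => [//|r IH] t /=; case E : (regen g r) => [s|//] /= H.
have : first_renewal g s.+1 = Some t by [].
move=> /first_renewalP[st _ _]; exact: leq_ltn_trans (IH _ E) st.
Qed.

(** Write [R(n) = r.+1]. Minimality gives a finite [T_r < n], and no renewal lies strictly between
    [T_r] and its successor, which is at least [n] or infinite. *)
Lemma TR_first_renewal g n : (0 < n)%N -> TR g n = first_renewal g n.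
Proof.
move=> n0; rewrite /TR /Rn; case: pselect => [ex|nex]; last first.
  (* Renewal times increase strictly, so [T_n] is at least [n] or infinite, and [R(n)] exists. *)
  exfalso; apply: nex; exists n; case E : (regen g n) => [t|//].
  exact: regen_ge E.
case: ex_minnP => -[|r]; first by rewrite /= leqNgt n0.
move=> pr rmin.
have [t rt tn] : exists2 t, regen g r = Some t & (t < n)%N.
  case E : (regen g r) => [t|]; last by have := rmin r; rewrite E ltnn => /(_ isT).
  exists t => //; rewrite ltnNge; apply/negP => nt.
  by have := rmin r; rewrite E nt ltnn => /(_ isT).
rewrite /= rt /= -[next_regen g t]/(first_renewal g t.+1).
case E : (first_renewal g t.+1) => [s|]; symmetry; last first.
  apply/first_renewal_None => s ns; move/first_renewal_None: E; apply.
  exact: leq_trans tn ns.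
apply: (first_renewal_ge E); rewrite tn/=.
by move: pr; rewrite /= rt /= -[next_regen g t]/(first_renewal g t.+1) E.
Qed.

End first_renewal.

(** * Renewal time and overshoot as extended reals *)

Section renewal_functionals.
Context {R : realType}.
Implicit Types (g : nat -> bool) (m n : nat).

Definition Nbar g m : \bar R :=
  if first_renewal g m is Some s then (s%:R)%:E else +oo.

Definition Vbar g m : \bar R :=
  if first_renewal g m is Some s then ((s - m)%N%:R)%:E else +oo.

Lemma Nbar_ge0 g m : 0 <= Nbar g m.
Proof. by rewrite /Nbar; case: first_renewal => [s|//]; rewrite lee_fin. Qed.

Lemma Vbar_ge0 g m : 0 <= Vbar g m.
Proof. by rewrite /Vbar; case: first_renewal => [s|//]; rewrite lee_fin. Qed.

Lemma NbarE g m : Nbar g m = (m%:R)%:E + Vbar g m.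
Proof.
rewrite /Nbar /Vbar; case E : first_renewal => [s|//].
move/first_renewalP : E => [ms _ _].
by rewrite -EFinD -natrD subnKC.
Qed.

Lemma NbarS g n :
  Nbar g n.+1 = Nbar g n + (if renewal g n then Nbar (shift n g) 1 else 0).
Proof.
case: ifPn => [rn|rn]; last by rewrite adde0 /Nbar first_renewalS.
rewrite /Nbar (first_renewal_id rn) -addn1 first_renewal_shift//.
case: first_renewal => [s|//] /=.
by rewrite -EFinD -natrD.
Qed.

(** Stated without subtraction, so that it holds in [\bar R] even when the next
    renewal time is infinite. *)
Lemma VbarS g n :
  Vbar g n.+1 ^+ 2 + Vbar g n.+1 + Vbar g n +
    (if renewal g n then Nbar (shift n g) 1 else 0) =
  Vbar g n ^+ 2 + (if renewal g n then Nbar (shift n g) 1 ^+ 2 else 0).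
Proof.
case: ifPn => rn.
  rewrite /Vbar (first_renewal_id rn) -addn1 first_renewal_shift// /Nbar.
  case E : (first_renewal (shift n g) 1) => [s|]; last first.
    by rewrite [omap _ _]/= subnn !expe2 mul0e add0e mulyy.
  move/first_renewalP : E => [s0 _ _].
  rewrite [omap _ _]/= addn1 -[n.+1]addn1 subnn subnDl -!EFin_expe -!EFinD.
  congr EFin.
  by case: s s0 => // s _; rewrite subn1/= -natr1; ring.
rewrite /Vbar first_renewalS//; case E : first_renewal => [s|//].
move/first_renewalP : E => [ns rs _].
have {}ns : (n < s)%N.
  by move: ns; rewrite leq_eqVlt => /predU1P[nE|//]; rewrite nE rs in rn.
rewrite !adde0 -!EFin_expe -!EFinD; congr EFin.
have -> : (s - n = (s - n.+1).+1)%N by lia.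
by rewrite -natr1; ring.
Qed.

(** This is [(V_n - v)^2 >= 0]; integrated at [v = E V_n] it gives [v^2 <= E V_n^2]. *)
Lemma Vbar_sqr_ge g n (v : R) :
  (2 * v)%:E * Vbar g n <= Vbar g n ^+ 2 + (v ^+ 2)%:E.
Proof.
rewrite /Vbar; case: first_renewal => [s|]; last by rewrite expe2 mulyy addye// leey.
rewrite -EFin_expe -EFinM -EFinD lee_fin.
have := sqr_ge0 ((s - n)%N%:R - v)%R; lra.
Qed.

(** If [N_n >= n + m] then [N_(n+m) = N_n]. Otherwise the path starts afresh at [N_n = n + k] with
    [k < m], and its first renewal after [m] further steps lies at or beyond [n + m]. At most one
    term of the sum is nonzero; the sum separates the values of [N_n] so that regeneration applies
    to each. *)
Lemma NbarD g n m : Nbar g (n + m) <= Nbar g n +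
  \sum_(k < m) (if first_renewal g n == Some (n + k)%N
                then Nbar (shift (n + k) g) m else 0).
Proof.
have if0 (bb : bool) (x : \bar R) : 0 <= x -> 0 <= (if bb then x else 0).
  by case: bb.
rewrite [X in _ <= X + _]/Nbar; case E : (first_renewal g n) => [s|]; last first.
  rewrite addye ?leey// gt_eqF// (lt_le_trans (ltNyr 0%R))// sume_ge0//.
have [ns rs _] := (first_renewalP _ _ _).1 E.
have [nms|snm] := leqP (n + m) s.
  rewrite [X in X <= _]/Nbar (first_renewal_ge E) ?leq_addr// leeDl// sume_ge0// => k _.
  by apply: if0; exact: Nbar_ge0.
have km : (s - n < m)%N by lia.
rewrite (bigD1 (Ordinal km))//= subnKC// eqxx addeA.
apply: (@le_trans _ _ ((s%:R)%:E + Nbar (shift s g) m)); last first.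
  rewrite leeDl// sume_ge0// => k _; apply: if0; exact: Nbar_ge0.
rewrite [X in _ <= _ + X]/Nbar; case F : (first_renewal (shift s g) m) => [r|]; last first.
  by rewrite addey// leey.
have [mr rr _] := (first_renewalP _ _ _).1 F.
rewrite renewal_shift// in rr.
have [t Et tsr] : exists2 t, first_renewal g (n + m) = Some t & (t <= s + r)%N.
  by apply: first_renewal_le => //; lia.
by rewrite /Nbar Et -EFinD lee_fin -natrD ler_nat.
Qed.

End renewal_functionals.

(** * Regenerative processes *)

(** The numerical core of (ii): [v] and [B] are the first two moments of the overshoot, [u] the
    renewal probabilities, [mu] and [t2] the first two moments of a cycle. The hypotheses combine to
    [(n + v n) * v n <= (t2 - mu) * U] with [mu * U = n + v n], and the factor [n + v n] cancels. *)
Lemma lorden_arith (R : realType) (v B u : nat -> R) (mu t2 : R) (n : nat) :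
  (0 < mu)%R -> (0 < n)%N -> v 0%N = 0%R -> B 0%N = 0%R ->
  (forall k, 0 <= v k)%R ->
  (forall k, k%:R + v k = mu * \sum_(i < k) u i)%R ->
  (forall k, B k.+1 + v k.+1 + v k + u k * mu = B k + u k * t2)%R ->
  (forall j k, v (j + k)%N <= v j + v k)%R ->
  (v n ^+ 2 <= B n)%R ->
  (v n <= t2 / mu - 1)%R.
Proof.
move=> mu0 n0 v0 B0 v_ge0 renew recB vD vB.
have tele k : (B k - v k + 2 * \sum_(i < k.+1) v i = (t2 - mu) * \sum_(i < k) u i)%R.
  elim: k => [|k IH]; first by rewrite big_ord1 big_ord0 v0 B0; ring.
  rewrite big_ord_recr/= [in RHS]big_ord_recr/= [in RHS]mulrDr -IH.
  have := recB k; lra.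
(* Sum [v n <= v i + v (n - i)] over [i <= n], after reversing one copy of the sum. *)
have avg : (n.+1%:R * v n <= 2 * \sum_(i < n.+1) v i)%R.
  rewrite mulr_natl mulr_natl mulr2n [X in (_ <= X + _)%R](reindex_inj rev_ord_inj)/=.
  rewrite -big_split/= -[X in (_ *+ X)%R]card_ord -sumr_const.
  apply: ler_sum => i _; rewrite subSS addrC.
  have -> : v n = v (i + (n - i))%N by rewrite subnKC// -ltnS.
  exact: vD.
have nv : (0 < n%:R + v n)%R by rewrite ltr_pwDl ?ltr0n.
have := renew n; have := tele n.
set U := (\sum_(i < n) u i)%R => teln renn.
rewrite lerBrDr ler_pdivlMr//.
rewrite -(ler_pM2r nv).
have UE : U = ((n%:R + v n) / mu)%R by rewrite renn mulrAC divff ?mul1r// gt_eqF.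
rewrite -natr1 in avg.
have H : ((n%:R + v n) * v n <= (t2 - mu) * U)%R by move: avg vB teln; nra.
have H2 : ((n%:R + v n) * v n * mu <= (t2 - mu) * (n%:R + v n))%R.
  by rewrite -ler_pdivlMr// -mulrA -UE.
by move: H2; nra.
Qed.

Lemma emeasurable_sqr {d : measure_display} {S : measurableType d} {R : realType}
    (f : S -> \bar R) :
  measurable_fun setT f -> measurable_fun setT (fun x => f x ^+ 2).
Proof.
move=> mf; rewrite (_ : (fun x => _) = (fun x => f x * f x)).
  exact: emeasurable_funM.
by apply/funext => x; rewrite expe2.
Qed.

(** * Measurability of renewal times *)

Section measurable_first_renewal.
Context {d : measure_display} {S : measurableType d}.

Lemma measurable_renewal (g : S -> nat -> bool) s :
  (forall i, (i < s)%N -> measurable_fun setT (g^~ i)) ->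
  measurable [set x | renewal (g x) s].
Proof.
case: s => [|s] mg; first by rewrite (_ : [set _ | _] = setT)//; apply/seteqP; split.
rewrite (_ : [set _ | _] = setT `&` (g^~ s) @^-1` [set true]).
  exact: mg.
by apply/seteqP; split=> x; rewrite setTI.
Qed.

Lemma measurable_first_renewal (g : S -> nat -> bool) m s :
  (forall i, (i < s)%N -> measurable_fun setT (g^~ i)) ->
  measurable [set x | first_renewal (g x) m = Some s].
Proof.
move=> mg; have [ms|sm] := leqP m s; last first.
  rewrite (_ : [set _ | _] = set0)//; apply/seteqP; split=> x //=.
  by move=> /first_renewalP[]; rewrite leqNgt sm.
rewrite (_ : [set _ | _] = [set x | renewal (g x) s] `&`
    \bigcap_(j in [set j | (m <= j < s)%N]) ~` [set x | renewal (g x) j]).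
  apply: measurableI; first exact: measurable_renewal.
  apply: bigcap_measurableType => j /andP[_ js]; apply: measurableC.
  by apply: measurable_renewal => i ij; apply: mg; exact: ltn_trans ij js.
apply/seteqP; split=> x /=.
  by move=> /first_renewalP[_ rs smin]; split=> // j /smin /negP.
by move=> [rs smin]; apply/first_renewalP; split=> // j /smin /negP.
Qed.

Lemma measurable_first_renewal_None (g : S -> nat -> bool) m :
  (forall i, measurable_fun setT (g^~ i)) ->
  measurable [set x | first_renewal (g x) m = None].
Proof.
move=> mg.
rewrite (_ : [set x | _] = ~` \bigcup_s [set x | first_renewal (g x) m = Some s]).
  apply: measurableC; apply: bigcup_measurable => s _.
  by apply: measurable_first_renewal => i _.
apply/seteqP; split=> x; rewrite /setC /mkset.
  by move=> E [t _]; rewrite /mkset E.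
move=> nU; case E : (first_renewal (g x) m) => [t|//].
by exfalso; apply: nU; exists t.
Qed.

(** Gluing over the countably many values of [h]; it serves every functional defined by matching on
    a renewal time. *)
Lemma measurable_fun_option {d'} {Y : measurableType d'}
    (h : S -> option nat) (F : option nat -> S -> Y) :
  (forall s, measurable [set x | h x = Some s]) ->
  (forall o, measurable_fun setT (F o)) ->
  measurable_fun setT (fun x => F (h x) x).
Proof.
move=> mh mF _ A mA; rewrite setTI.
have mN : measurable [set x | h x = None].
  rewrite (_ : [set _ | _] = ~` \bigcup_s [set x | h x = Some s]).
    by apply: measurableC; apply: bigcup_measurable.
  apply/seteqP; split=> x /=.
    by move=> hN [s _] /=; rewrite hN.
  by case E : (h x) => [s|//] [] ; exists s.
rewrite (_ : _ @^-1` _ = ([set x | h x = None] `&` F None @^-1` A) `|`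
    \bigcup_s ([set x | h x = Some s] `&` F (Some s) @^-1` A)).
  apply: measurableU.
    by apply: measurableI => //; rewrite -[X in measurable X]setTI; exact: mF.
  apply: bigcup_measurable => s _; apply: measurableI => //.
  by rewrite -[X in measurable X]setTI; exact: mF.
apply/seteqP; split=> x /=.
  by case E : (h x) => [s|] Fx; [right; exists s|left].
by move=> [[-> //]|[s _ [/= -> //]]].
Qed.

Lemma measurable_Nbar {R : realType} (g : S -> nat -> bool) m :
  (forall i, measurable_fun setT (g^~ i)) ->
  measurable_fun setT (fun x => @Nbar R (g x) m).
Proof.
move=> mg; apply: (measurable_fun_option (h := fun x => first_renewal (g x) m)
  (F := fun o _ => if o is Some s then (s%:R)%:E else +oo)) => // s.
by apply: measurable_first_renewal => i _.
Qed.

Lemma measurable_Vbar {R : realType} (g : S -> nat -> bool) m :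
  (forall i, measurable_fun setT (g^~ i)) ->
  measurable_fun setT (fun x => @Vbar R (g x) m).
Proof.
move=> mg; apply: (measurable_fun_option (h := fun x => first_renewal (g x) m)
  (F := fun o _ => if o is Some s then ((s - m)%N%:R)%:E else +oo)) => // s.
by apply: measurable_first_renewal => i _.
Qed.

End measurable_first_renewal.

Lemma probability_integral_cst {d : measure_display} {S : measurableType d}
    {R : realType} (Pr : probability S R) (c : R) : \int[Pr]_w c%:E = c%:E.
Proof.
rewrite integral_cst// -[RHS]mule1; congr (_ * _); exact: probability_setT.
Qed.

Section regenerative_process.
Context {d d' : measure_display} {T : measurableType d} {Om : measurableType d'}
  {R : realType}.
Variables (Pr : probability Om R) (Xs : nat -> Om -> T) (G : nat -> Om -> bool).
Hypothesis mX : forall n, measurable_fun setT (Xs n).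
Hypothesis mG : forall n, measurable [set w | G n w].
Hypothesis regen_indep : forall s (D : set (past_space T s.+1)) (H : set (path_space T)),
  measurable D -> measurable H ->
  Pr ([set w | G s w] `&` traj Xs G 0 @^-1` D `&` traj Xs G s.+1 @^-1` H) =
  Pr ([set w | G s w] `&` traj Xs G 0 @^-1` D) * Pr (traj Xs G 0 @^-1` H).

Let mtraj N k : measurable_fun setT
  (traj Xs G k : Om -> g_sigma_algebraType (cylinders T N)).
Proof. exact: measurable_traj. Qed.

Let mpath k : measurable_fun setT (traj Xs G k : Om -> path_space T).
Proof. exact: mtraj. Qed.

Let mpast s : measurable_fun setT (traj Xs G 0 : Om -> past_space T s).
Proof. exact: mtraj. Qed.

(** By [regen_indep] and uniqueness of product measures, the joint law of past and future on [G s]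
    is the product of the law of the past with that of a fresh path; Tonelli does the rest. *)
Lemma regen_fubini s (Phi : past_space T s.+1 * path_space T -> \bar R) :
  measurable_fun setT Phi -> (forall z, 0 <= Phi z) ->
  \int[Pr]_(w in [set w | G s w]) Phi (traj Xs G 0 w, traj Xs G s.+1 w) =
  \int[Pr]_(w in [set w | G s w]) \int[Pr]_w' Phi (traj Xs G 0 w, traj Xs G 0 w').
Proof.
move=> mPhi Phi0.
pose m0 : measurable_fun setT (traj Xs G 0 : Om -> past_space T s.+1) := @mpast _.
pose m1 : measurable_fun setT (traj Xs G s.+1 : Om -> path_space T) := @mpath _.
pose m2 : measurable_fun setT (traj Xs G 0 : Om -> path_space T) := @mpath _.
pose M1 := law_on Pr (mG s) m0.
pose M2 := law_on Pr measurableT m2.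
pose M := law_on Pr (mG s) (measurable_fun_pair m0 m1).
transitivity (\int[M]_z Phi z).
  by rewrite ge0_integral_law_on.
transitivity (\int[M1 \x M2]_z Phi z).
  apply: eq_measure_integral => A mA _.
  apply/esym; apply: product_measure_unique => // D H mD mH.
  have := regen_indep mD mH.
  rewrite /= /M1 /M2 /M /law_on /pushforward /mrestr/= setIT.
  rewrite [X in _ = Pr X * _ -> _]setIC => <-.
  by congr (Pr _); apply/seteqP; split=> w /=; [case=> -[]|case=> -[]].
rewrite fubini_tonelli1// ge0_integral_law_on//.
- apply: eq_integral => w _; rewrite /fubini_F ge0_integral_law_on//.
  exact: (measurableT_comp mPhi (pair1_measurable _)).
- exact: measurable_fun_fubini_tonelli_F.
- by move=> z; apply: integral_ge0 => z' _.
Qed.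


Lemma regen_integral s (D : set (past_space T s.+1)) (H : path_space T -> \bar R) :
  measurable D -> measurable_fun setT H -> (forall p, 0 <= H p) ->
  \int[Pr]_(w in [set w | G s w] `&` traj Xs G 0 @^-1` D) H (traj Xs G s.+1 w) =
  Pr ([set w | G s w] `&` traj Xs G 0 @^-1` D) * \int[Pr]_w H (traj Xs G 0 w).
Proof.
move=> mD mH H0; set E := _ `&` _.
have mE : measurable E.
  by apply: measurableI => //; rewrite -[X in measurable X]setTI; apply: (@mpast s.+1).
have PrE : (fine (Pr E))%:E = Pr E by rewrite fineK// fin_num_measure.
rewrite -PrE.
apply: (@ge0_integral_eq_law _ _ _ Om Om (path_space T) R Pr Pr E setT
  (traj Xs G s.+1) (traj Xs G 0) _ H) => //.
- exact: fine_ge0.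
- by move=> A mA; rewrite setTI PrE; exact: regen_indep.
Qed.

Let ren n := [set w | renewal (G^~ w) n].

Let mren n : measurable (ren n).
Proof. by apply: measurable_renewal => i _; exact: measurable_funG. Qed.

Lemma renewal_integral n (H : path_space T -> \bar R) :
  measurable_fun setT H -> (forall p, 0 <= H p) ->
  \int[Pr]_(w in ren n) H (traj Xs G n w) = Pr (ren n) * \int[Pr]_w H (traj Xs G 0 w).
Proof.
move=> mH H0; case: n => [|n].
  have -> : ren 0 = setT by apply/seteqP; split.
  by rewrite probability_setT mul1e.
have := regen_integral (D := setT) measurableT mH H0 (s := n).
rewrite preimage_setT setIT.
by have -> : ren n.+1 = [set w | G n w] by apply/seteqP; split.
Qed.

(** Regeneration at the random time [N_n]: the event [N_n = k.+1] belongs to the past of [k.+1] and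
    is contained in [G k]. *)
Lemma first_renewal_integral n k (H : path_space T -> \bar R) :
  measurable_fun setT H -> (forall p, 0 <= H p) ->
  \int[Pr]_(w in [set w | first_renewal (G^~ w) n = Some k]) H (traj Xs G k w) =
  Pr [set w | first_renewal (G^~ w) n = Some k] * \int[Pr]_w H (traj Xs G 0 w).
Proof.
move=> mH H0; case: k => [|k].
  case: n => [|n].
    rewrite (_ : [set _ | _] = setT); first by rewrite probability_setT mul1e.
    by apply/seteqP; split.
  rewrite (_ : [set _ | _] = set0); first by rewrite integral_set0 measure0 mul0e.
  by apply/seteqP; split=> // w /= /(first_renewalP _ n.+1)[].
pose D : set (past_space T k.+1) :=
  [set p | first_renewal (fun i => (p i).2) n = Some k.+1].
have mD : measurable D.
  apply: measurable_first_renewal => i ik.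
  exact: (@measurable_snd_coord _ _ _ k.+1).
have := regen_integral mD mH H0.
rewrite (_ : _ `&` _ = [set w | first_renewal (G^~ w) n = Some k.+1])//.
apply/seteqP; split=> w /=; first by case.
by move=> E; split=> //; move/first_renewalP : E => [_].
Qed.

Let mNb m : measurable_fun setT (fun w => @Nbar R (G^~ w) m).
Proof. by apply: measurable_Nbar => i; exact: measurable_funG. Qed.

Let mVb m : measurable_fun setT (fun w => @Vbar R (G^~ w) m).
Proof. by apply: measurable_Vbar => i; exact: measurable_funG. Qed.

Let gp (p : path_space T) : nat -> bool := fun i => (p i).2.

Let mNbp m : measurable_fun setT (fun p : path_space T => @Nbar R (gp p) m).
Proof.
apply: measurable_Nbar => i.
exact: (@measurable_snd_coord _ _ _ i.+1).
Qed.

Let integral_if (D : set Om) (c : Om -> bool) (H : Om -> \bar R) :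
  (forall w, c w <-> D w) ->
  \int[Pr]_w (if c w then H w else 0) = \int[Pr]_(w in D) H w.
Proof.
move=> cD; rewrite [RHS]integral_mkcond; apply: eq_integral => w _.
rewrite patchE; case: ifPn => [/cD Dw|nc]; first by rewrite mem_set.
by rewrite memNset// => /cD; exact/negP.
Qed.

Let measurable_if (D : set Om) (c : Om -> bool) (H : Om -> \bar R) :
  measurable D -> (forall w, c w <-> D w) -> measurable_fun setT H ->
  measurable_fun setT (fun w => if c w then H w else 0).
Proof.
move=> mD cD mH; apply: measurable_fun_ifT => //.
apply: (@measurable_fun_bool _ _ _ _ true); rewrite setTI.
by rewrite (_ : _ @^-1` _ = D)//; apply/seteqP; split=> w /cD.
Qed.

Let if_ge0 (c : bool) (x : \bar R) : 0 <= x -> 0 <= (if c then x else 0).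
Proof. by case: c. Qed.

(** * Moments of renewal times and overshoots *)

Lemma integral_NbarS n :
  \int[Pr]_w Nbar (G^~ w) n.+1 =
  \int[Pr]_w Nbar (G^~ w) n + Pr (ren n) * \int[Pr]_w Nbar (G^~ w) 1.
Proof.
under eq_integral do rewrite NbarS.
rewrite ge0_integralD//; last 3 first.
- by move=> w _; exact: Nbar_ge0.
- by move=> w _; apply: if_ge0; exact: Nbar_ge0.
- apply: (measurable_if (mren n)) => //.
  exact: (measurableT_comp (mNbp 1) (mpath n)).
congr (_ + _); rewrite (integral_if (D := ren n))//.
apply: (@renewal_integral n (fun p => Nbar (gp p) 1)) => // p.
exact: Nbar_ge0.
Qed.

Lemma integral_Nbar n :
  \int[Pr]_w Nbar (G^~ w) n =
  (\sum_(k < n) Pr (ren k)) * \int[Pr]_w Nbar (G^~ w) 1.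
Proof.
elim: n => [|n IH]; first by rewrite big_ord0 mul0e integral0_eq.
rewrite integral_NbarS IH big_ord_recr/= [RHS]ge0_muleDl//.
by apply: sume_ge0 => k _.
Qed.

Lemma integral_VbarS n :
  \int[Pr]_w (Vbar (G^~ w) n.+1 ^+ 2) + \int[Pr]_w Vbar (G^~ w) n.+1 +
    \int[Pr]_w Vbar (G^~ w) n + Pr (ren n) * \int[Pr]_w Nbar (G^~ w) 1 =
  \int[Pr]_w (Vbar (G^~ w) n ^+ 2) +
    Pr (ren n) * \int[Pr]_w (Nbar (G^~ w) 1 ^+ 2).
Proof.
have V0 m w : 0 <= @Vbar R (G^~ w) m by exact: Vbar_ge0.
have mV2 m : measurable_fun setT (fun w => @Vbar R (G^~ w) m ^+ 2).
  exact: emeasurable_sqr.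
have mN2p : measurable_fun setT (fun p : path_space T => @Nbar R (gp p) 1 ^+ 2).
  exact: emeasurable_sqr.
have V20 m w : 0 <= @Vbar R (G^~ w) m ^+ 2 by rewrite expe_ge0.
have N20 g m : 0 <= @Nbar R g m ^+ 2 by rewrite expe_ge0 ?Nbar_ge0.
have e1 : Pr (ren n) * \int[Pr]_w Nbar (G^~ w) 1 =
    \int[Pr]_w (if renewal (G^~ w) n then Nbar (shift n (G^~ w)) 1 else 0).
  rewrite (integral_if (D := ren n))//.
  rewrite -(@renewal_integral n (fun p => Nbar (gp p) 1))// => p.
  exact: Nbar_ge0.
have e2 : Pr (ren n) * \int[Pr]_w (Nbar (G^~ w) 1 ^+ 2) =
    \int[Pr]_w (if renewal (G^~ w) n then Nbar (shift n (G^~ w)) 1 ^+ 2 else 0).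
  rewrite (integral_if (D := ren n))//.
  by rewrite -(@renewal_integral n (fun p => Nbar (gp p) 1 ^+ 2)).
have m1 : measurable_fun setT (fun w =>
    if renewal (G^~ w) n then @Nbar R (shift n (G^~ w)) 1 else 0).
  apply: (measurable_if (mren n)) => //.
  exact: (measurableT_comp (mNbp 1) (mpath n)).
have m2 : measurable_fun setT (fun w =>
    if renewal (G^~ w) n then @Nbar R (shift n (G^~ w)) 1 ^+ 2 else 0).
  apply: (measurable_if (mren n)) => //.
  exact: (measurableT_comp mN2p (mpath n)).
have if1 w : 0 <= (if renewal (G^~ w) n then @Nbar R (shift n (G^~ w)) 1 else 0).
  by apply: if_ge0; exact: Nbar_ge0.
have if2 w : 0 <=
    (if renewal (G^~ w) n then @Nbar R (shift n (G^~ w)) 1 ^+ 2 else 0).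
  exact: if_ge0.
rewrite e1 e2 -!ge0_integralD//.
- by apply: eq_integral => w _; exact: VbarS.
all: try by move=> w _; rewrite ?adde_ge0.
all: by do ?apply: emeasurable_funD.
Qed.

(** Regeneration at [n + k] factors each term of [NbarD]; the events [N_n = n + k] are disjoint, so
    their probabilities add up to at most [1]. *)
Lemma integral_NbarD n m :
  \int[Pr]_w Nbar (G^~ w) (n + m) <=
  \int[Pr]_w Nbar (G^~ w) n + \int[Pr]_w Nbar (G^~ w) m.
Proof.
pose F k w := if first_renewal (G^~ w) n == Some (n + k)%N
   then @Nbar R (shift (n + k) (G^~ w)) m else 0.
pose D k := [set w | first_renewal (G^~ w) n = Some k].
have mD k : measurable (D k).
  by apply: measurable_first_renewal => i _; exact: measurable_funG.
have FD k w : first_renewal (G^~ w) n == Some (n + k)%N <-> D (n + k)%N w.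
  by split=> /eqP.
have mF k : measurable_fun setT (F k).
  apply: (measurable_if (mD (n + k)%N)) => //.
  exact: (measurableT_comp (mNbp m) (mpath (n + k))).
have F0 k w : 0 <= F k w by apply: if_ge0; exact: Nbar_ge0.
apply: (@le_trans _ _ (\int[Pr]_w (Nbar (G^~ w) n + \sum_(k < m) F k w))).
  apply: ge0_le_integral => //.
  - by move=> w _; exact: Nbar_ge0.
  - by apply: emeasurable_funD => //; exact: emeasurable_sum.
  - by move=> w _; exact: NbarD.
rewrite ge0_integralD//; last 3 first.
- by move=> w _; exact: Nbar_ge0.
- by move=> w _; apply: sume_ge0.
- exact: emeasurable_sum.
rewrite leeD2l// ge0_integral_sum//.
have N0 : 0 <= \int[Pr]_w Nbar (G^~ w) m.
  by apply: integral_ge0 => w _; exact: Nbar_ge0.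
rewrite (eq_bigr (fun k : 'I_m => Pr (D (n + k)%N) * \int[Pr]_w Nbar (G^~ w) m)).
  rewrite -ge0_sume_distrl//.
  rewrite -[leRHS]mul1e lee_wpmul2r//.
  have := @measure_bigsetU_ord _ _ _ Pr m xpredT (fun k => D (n + k)%N).
  move=> <- //; first by apply: probability_le1; exact: bigsetU_measurable.
  apply/trivIsetP => i j _ _ ij; apply/seteqP; split=> // w [].
  rewrite /D/= => -> [] /addnI /val_inj eij.
  by rewrite eij eqxx in ij.
move=> k _; rewrite (integral_if (D := D (n + k)%N))//.
apply: (@first_renewal_integral n (n + k) (fun p => Nbar (gp p) m)) => // p.
exact: Nbar_ge0.
Qed.

Lemma integral_Nbar1_ge1 : 1 <= \int[Pr]_w @Nbar R (G^~ w) 1.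
Proof.
apply: (@le_trans _ _ (\int[Pr]_w 1)).
  by rewrite probability_integral_cst.
apply: ge0_le_integral => // w _; rewrite NbarE leeDl//.
exact: Vbar_ge0.
Qed.

(** As [N_1 >= 1], it is bounded by its square. *)
Lemma integral_Nbar1_lty :
  \int[Pr]_w (@Nbar R (G^~ w) 1 ^+ 2) < +oo -> \int[Pr]_w @Nbar R (G^~ w) 1 < +oo.
Proof.
apply: le_lt_trans; apply: ge0_le_integral => //.
- by move=> w _; exact: Nbar_ge0.
- exact: emeasurable_sqr.
- move=> w _; rewrite expe2 -[leLHS]mule1 lee_pmul// ?Nbar_ge0//.
  by rewrite NbarE leeDl// Vbar_ge0.
Qed.

Lemma integral_Nbar_fin n : \int[Pr]_w (@Nbar R (G^~ w) 1) < +oo ->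
  \int[Pr]_w (@Nbar R (G^~ w) n) \is a fin_num.
Proof.
move=> N1; rewrite integral_Nbar; apply: fin_numM.
  by apply/sum_fin_numP => k _ _; exact: fin_num_measure.
rewrite ge0_fin_numE//; apply: integral_ge0 => w _; exact: Nbar_ge0.
Qed.

(** [Nbar] is infinite where no renewal follows, yet its mean is finite. *)
Lemma first_renewal_None_null n : \int[Pr]_w (@Nbar R (G^~ w) 1) < +oo ->
  Pr [set w | first_renewal (G^~ w) n = None] = 0.
Proof.
move=> N1; have := integral_Nbar_fin n N1 => Nfin.
have intN : Pr.-integrable setT (fun w => @Nbar R (G^~ w) n).
  apply/integrableP; split => //.
  under eq_integral do rewrite gee0_abs ?Nbar_ge0//.
  by rewrite ltey_eq Nfin.
have [N [mN N0 subN]] := integrable_ae measurableT intN.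
have HN : [set w | first_renewal (G^~ w) n = None] `<=` N.
  by move=> w E; apply: subN => /= /(_ I); rewrite /Nbar (E : first_renewal _ _ = _).
apply/eqP; rewrite eq_le measure_ge0 andbT -N0 le_measure ?inE//.
by apply: measurable_first_renewal_None => i; exact: measurable_funG.
Qed.

(** Lorden's inequality for the mean overshoot. All moments are first shown finite, so that the
    identities in [\bar R] can be read in [R] and handed to [lorden_arith]. *)
Lemma lorden n : (0 < n)%N -> \int[Pr]_w (@Nbar R (G^~ w) 1 ^+ 2) < +oo ->
  \int[Pr]_w @Nbar R (G^~ w) n <=
  (n%:R + (fine (\int[Pr]_w (@Nbar R (G^~ w) 1 ^+ 2)) /
           fine (\int[Pr]_w @Nbar R (G^~ w) 1) - 1))%:E.
Proof.
move=> n0 N2.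
have V0 m w : 0 <= @Vbar R (G^~ w) m by exact: Vbar_ge0.
have V20 m w : 0 <= @Vbar R (G^~ w) m ^+ 2 by rewrite expe_ge0.
have N1 := integral_Nbar1_lty N2.
set t2 := \int[Pr]_w _ in N2 *; set mu := \int[Pr]_w _ in N1 *.
pose EV k := \int[Pr]_w @Vbar R (G^~ w) k.
pose EV2 k := \int[Pr]_w (@Vbar R (G^~ w) k ^+ 2).
have ENE k : \int[Pr]_w @Nbar R (G^~ w) k = (k%:R)%:E + EV k.
  under eq_integral do rewrite NbarE.
  rewrite ge0_integralD//; congr (_ + _).
  exact: probability_integral_cst.
have EV_ge0 k : 0 <= EV k by exact: integral_ge0.
have EV2_ge0 k : 0 <= EV2 k by exact: integral_ge0.
have EVfin k : EV k \is a fin_num.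
  by have := integral_Nbar_fin k N1; rewrite ENE fin_numD => /andP[].
have Prfin i : Pr (ren i) \is a fin_num by apply: fin_num_measure; exact: mren.
have t2fin : t2 \is a fin_num.
  by rewrite ge0_fin_numE//; apply: integral_ge0 => w _; rewrite expe_ge0// Nbar_ge0.
have mufin : mu \is a fin_num.
  by rewrite ge0_fin_numE//; apply: integral_ge0 => w _; exact: Nbar_ge0.
have V00 w : @Vbar R (G^~ w) 0 = 0 by rewrite /Vbar.
have recE i : EV2 i.+1 + EV i.+1 + EV i + Pr (ren i) * mu = EV2 i + Pr (ren i) * t2.
  exact: integral_VbarS.
(* All terms of [recE] are nonnegative, so its right side bounds [EV2 k.+1], and finiteness
   propagates from [EV2 0 = 0]. *)
have EV2fin k : EV2 k \is a fin_num.
  elim: k => [|k IH]; first by rewrite /EV2 integral0_eq// => w _; rewrite V00 expe2 mule0.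
  rewrite ge0_fin_numE//; apply: (@le_lt_trans _ _ (EV2 k + Pr (ren k) * t2)).
    rewrite -recE -(addeA (EV2 _)) -(addeA (EV2 _)) leeDl//.
    apply: adde_ge0; first exact: adde_ge0.
    by apply: mule_ge0 => //; apply: integral_ge0 => w _; exact: Nbar_ge0.
  by rewrite ltey_eq fin_numD IH fin_numM.
have mu1 : 1 <= mu by exact: integral_Nbar1_ge1.
rewrite ENE -(fineK (EVfin n)) -EFinD lee_fin lerD2l.
apply: (@lorden_arith R (fun k => fine (EV k)) (fun k => fine (EV2 k))
  (fun k => fine (Pr (ren k)))) => //.
- by rewrite -lte_fin fineK// (lt_le_trans _ mu1).
- by rewrite /EV integral0_eq.
- by rewrite /EV2 integral0_eq// => w _; rewrite V00 expe2 mule0.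
- by move=> k; rewrite fine_ge0.
- move=> k; apply: EFin_inj; rewrite EFinD fineK// -ENE integral_Nbar -/mu muleC EFinM fineK//.
  congr (_ * _); rewrite -sumEFin; apply: eq_bigr => i _.
  by rewrite fineK.
- move=> k; apply: EFin_inj; rewrite !EFinD !EFinM !fineK//.
- move=> j k; have := integral_NbarD j k; rewrite !ENE.
  rewrite -(fineK (EVfin j)) -(fineK (EVfin k)) -(fineK (EVfin (j + k)%N)).
  by rewrite -!EFinD lee_fin natrD; lra.
- set v := fine (EV n).
  have v0 : (0 <= v)%R by rewrite fine_ge0.
  have : \int[Pr]_w ((2 * v)%:E * Vbar (G^~ w) n) <= \int[Pr]_w (Vbar (G^~ w) n ^+ 2 + (v ^+ 2)%:E).
    apply: ge0_le_integral => //.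
    + by move=> w _; rewrite mule_ge0// lee_fin mulr_ge0.
    + exact: measurable_funeM.
    + by apply: emeasurable_funD => //; exact: emeasurable_sqr.
    by move=> w _; exact: Vbar_sqr_ge.
  rewrite ge0_integralZl//; last by rewrite lee_fin mulr_ge0.
  rewrite ge0_integralD//; last 2 first.
  + exact: emeasurable_sqr.
  + by move=> w _; rewrite lee_fin sqr_ge0.
  rewrite -/(EV n) -/(EV2 n) probability_integral_cst.
  rewrite -(fineK (EVfin n)) -(fineK (EV2fin n)) -/v -!EFinM -EFinD lee_fin.
  by nra.
Qed.

(** * Second moments of block sums *)

Section square.
Variable phi : T -> R.
Hypothesis mphi : measurable_fun setT phi.

(** As a functional of the path, this is [W_n] of the overview; at [n = 1] it is the first block sum
    [Xi1]. *)
Definition block_sum n (p : path_space T) : R :=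
  if first_renewal (gp p) n is Some t then (\sum_(i < t) phi (p i).1)%R else 0%R.

Definition partial_sum n (w : Om) : R := (\sum_(i < n) phi (Xs i w))%R.

Lemma measurable_block_sum n : measurable_fun setT (block_sum n).
Proof.
apply: (measurable_fun_option (h := fun p : path_space T => first_renewal (gp p) n)
  (F := fun o p => if o is Some t then (\sum_(i < t) phi (p i).1)%R else 0%R)).
  move=> s; apply: measurable_first_renewal => i _.
  exact: (@measurable_snd_coord _ _ _ i.+1).
case=> [t|//]; apply: measurable_sum => i.
apply: (measurableT_comp mphi).
exact: (@measurable_fst_coord _ _ _ i.+1).
Qed.

Let xi w := block_sum 1 (traj Xs G 0 w).
Hypothesis int_xi : Pr.-integrable setT (EFin \o xi).
Hypothesis xi_mean0 : \int[Pr]_w (xi w)%:E = 0.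
Hypothesis xi_sq : \int[Pr]_w ((xi w) ^+ 2)%:E < +oo.

Let mxi : measurable_fun setT xi.
Proof. exact: (measurableT_comp (measurable_block_sum 1) (mpath 0)). Qed.

(** The cross term [2 * x * xi] integrates to [0]; this is where the zero mean of a block enters. *)
Let integral_shift_sqr (x : R) :
  \int[Pr]_w ((x + xi w) ^+ 2)%:E = (x ^+ 2)%:E + \int[Pr]_w ((xi w) ^+ 2)%:E.
Proof.
have int_sq : Pr.-integrable setT (fun w => ((xi w) ^+ 2)%:E).
  apply/integrableP; split.
    by apply/measurable_EFinP; exact: measurable_funX.
  by under eq_integral do rewrite gee0_abs ?lee_fin ?sqr_ge0//.
have int_cst (c : R) : Pr.-integrable setT (fun=> c%:E).
  exact: finite_measure_integrable_cst.
have int_lin : Pr.-integrable setT (fun w => ((2 * x) * xi w)%:E).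
  by under eq_fun do rewrite EFinM; exact: integrableZl.
under eq_integral => w _.
  rewrite (_ : ((x + xi w) ^+ 2)%:E =
    ((x ^+ 2)%:E + ((2 * x) * xi w)%:E) + ((xi w) ^+ 2)%:E); last first.
    by rewrite -!EFinD; congr EFin; ring.
  over.
rewrite integralD//; last exact: integrableD.
rewrite integralD//; congr (_ + _).
under [X in _ + X]eq_integral do rewrite EFinM.
rewrite integralZl// xi_mean0 mule0 adde0.
exact: probability_integral_cst.
Qed.

(** By [regen_fubini] the partial sum can be frozen at a value [x] while the next block is
    integrated as an independent copy of [xi]. *)
Lemma renewal_square n :
  \int[Pr]_(w in ren n) ((partial_sum n w + block_sum 1 (traj Xs G n w)) ^+ 2)%:E =
  \int[Pr]_(w in ren n) ((partial_sum n w) ^+ 2)%:E +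
  Pr (ren n) * \int[Pr]_w ((xi w) ^+ 2)%:E.
Proof.
case: n => [|n].
  have -> : ren 0 = setT by apply/seteqP; split.
  rewrite probability_setT mul1e [X in _ = X + _]integral0_eq ?add0e; last first.
    by move=> w _; rewrite /partial_sum big_ord0 expr0n.
  by apply: eq_integral => w _; rewrite /partial_sum big_ord0 add0r.
have -> : ren n.+1 = [set w | G n w] by apply/seteqP; split.
pose S (p : past_space T n.+1) : R := (\sum_(i < n.+1) phi (p i).1)%R.
have mS : measurable_fun setT S.
  apply: measurable_sum => i; apply: (measurableT_comp mphi).
  exact: (@measurable_fst_coord _ _ _ n.+1).
have := @regen_fubini n (fun z => ((S z.1 + block_sum 1 z.2) ^+ 2)%:E).
move=> -> /=.
- under eq_integral do rewrite integral_shift_sqr.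
  rewrite ge0_integralD//.
  + by rewrite integral_cst// muleC.
  + by move=> w _; rewrite lee_fin sqr_ge0.
  + apply/measurable_EFinP; apply: measurable_funTS.
    by apply: measurable_funX; exact: (measurableT_comp mS (@mpast n.+1)).
  + by move=> w _; apply: integral_ge0 => w' _; rewrite lee_fin sqr_ge0.
- apply/measurable_EFinP; apply: measurable_funX; apply: measurable_funD.
  + exact: (measurableT_comp mS measurable_fst).
  + exact: (measurableT_comp (measurable_block_sum 1) measurable_snd).
- by move=> z; rewrite lee_fin sqr_ge0.
Qed.

(** Only an inequality: [block_sum] is [0] where there is no further renewal. *)
Lemma integral_block_sum_sqrS n :
  \int[Pr]_w ((block_sum n.+1 (traj Xs G 0 w)) ^+ 2)%:E <=
  \int[Pr]_w ((block_sum n (traj Xs G 0 w)) ^+ 2)%:E +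
  Pr (ren n) * \int[Pr]_w ((xi w) ^+ 2)%:E.
Proof.
have mW m : measurable_fun setT (fun w => ((block_sum m (traj Xs G 0 w)) ^+ 2)%:E).
  apply/measurable_EFinP; apply: measurable_funX.
  exact: (measurableT_comp (measurable_block_sum m) (mpath 0)).
have mS : measurable_fun setT (partial_sum n).
  by apply: measurable_sum => i; exact: (measurableT_comp mphi).
have mCren : measurable (~` ren n) by exact: measurableC.
have spl (f : Om -> R) : measurable_fun setT (fun w => (f w ^+ 2)%:E) ->
    \int[Pr]_w (f w ^+ 2)%:E =
    \int[Pr]_(w in ren n) (f w ^+ 2)%:E + \int[Pr]_(w in ~` ren n) (f w ^+ 2)%:E.
  move=> mf; rewrite -ge0_integral_setU ?setUv//.
    by move=> w _; rewrite lee_fin sqr_ge0.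
  exact/disj_setPCl.
rewrite spl// [in leRHS]spl// addeAC; apply: leeD.
  have -> : \int[Pr]_(w in ren n) (block_sum n (traj Xs G 0 w) ^+ 2)%:E =
      \int[Pr]_(w in ren n) ((partial_sum n w) ^+ 2)%:E.
    apply: eq_integral => w /set_mem rw.
    by rewrite /block_sum (first_renewal_id (rw : renewal (gp (traj Xs G 0 w)) n)).
  rewrite -renewal_square; apply: ge0_le_integral => //.
  - by move=> w _; rewrite lee_fin sqr_ge0.
  - exact: measurable_funTS.
  - apply/measurable_EFinP; apply: measurable_funTS; apply: measurable_funX.
    apply: measurable_funD => //.
    exact: (measurableT_comp (measurable_block_sum 1) (mpath n)).
  move=> w rw; rewrite lee_fin /block_sum.
  rewrite -[in X in (X <= _)%R](addn1 n).
  rewrite (first_renewal_shift 1 (rw : renewal (gp (traj Xs G 0 w)) n)).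
  rewrite -[shift n _]/(gp (traj Xs G n w)).
  case: first_renewal => [t|] /=; last by rewrite expr0n/= sqr_ge0.
  by rewrite big_split_ord.
apply: ge0_le_integral => //.
- by move=> w _; rewrite lee_fin sqr_ge0.
- exact: measurable_funTS.
- exact: measurable_funTS.
move=> w rw; rewrite lee_fin /block_sum first_renewalS//.
exact/negP.
Qed.

Lemma integral_block_sum_sqr n :
  \int[Pr]_w ((block_sum n (traj Xs G 0 w)) ^+ 2)%:E <=
  (\sum_(k < n) Pr (ren k)) * \int[Pr]_w ((xi w) ^+ 2)%:E.
Proof.
elim: n => [|n IH].
  rewrite big_ord0 mul0e integral0_eq// => w _.
  by rewrite /block_sum/= big_ord0 expr0n.
apply: (le_trans (integral_block_sum_sqrS n)).
rewrite big_ord_recr/= [leRHS]ge0_muleDl//; last by apply: sume_ge0 => k _.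
by rewrite leeD2r.
Qed.

End square.

End regenerative_process.

(** * Kac's formula *)

Lemma adde_fin_inj {R : realType} (x y z : \bar R) :
  x \is a fin_num -> x + y = x + z -> y = z.
Proof.
by move=> xfin; rewrite ![x + _]addeC => xyz; rewrite -(addeK y xfin) xyz addeK.
Qed.

(** Subtraction is carried out among charges, and domination makes the resulting charge a measure.
    It will serve to form [pi] minus the scaled occupation measure. *)
Lemma measure_diff {d : measure_display} {T : measurableType d} {R : realType}
    (m1 : {measure set T -> \bar R}) (m2 : {finite_measure set T -> \bar R}) :
  (forall A, measurable A -> m1 A <= m2 A) ->
  exists rho : {measure set T -> \bar R},
    forall A, measurable A -> m2 A = m1 A + rho A.
Proof.
move=> m12.
have m1oo : m1 setT < +oo.
  by rewrite (le_lt_trans (m12 _ measurableT))// ltey_eq fin_num_measure.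
pose c1 := charge_of_finite_measure (mfrestr measurableT m1oo).
pose c2 := charge_of_finite_measure m2.
(* [crestr0] makes the charge vanish, hence nonnegative, on nonmeasurable sets *)
pose rho0 := crestr0 (cadd c2 (copp c1)) measurableT.
have rho0E A : measurable A -> rho0 A = m2 A - m1 A.
  move=> mA; rewrite /rho0 /crestr0 mem_set// /crestr setIT.
  by change (m2 A - m1 (A `&` setT) = m2 A - m1 A); rewrite setIT.
have m1fin A : measurable A -> m1 A \is a fin_num.
  move=> mA; rewrite ge0_fin_numE// (le_lt_trans (m12 _ mA))//.
  by rewrite ltey_eq fin_num_measure.
have rho0_ge0 A : 0 <= rho0 A.
  have [mA|nmA] := pselect (measurable A); last by rewrite /rho0 /crestr0 memNset.
  by rewrite rho0E// sube_ge0 ?m12// m1fin.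
exists (measure_of_charge rho0 rho0_ge0) => A mA.
change (m2 A = m1 A + rho0 A); rewrite rho0E// addeC subeK//.
exact: m1fin.
Qed.

Section kac.
Context {d d' : measure_display} {T : measurableType d} {Om : measurableType d'}
  {R : realType}.
Variables (P : R.-pker T ~> T) (J : set T) (beta : R) (nu pi : probability T R).
Hypotheses (mJ : measurable J) (beta_gt0 : (0 < beta)%R).
Hypothesis Hminor : forall x A, measurable A ->
  (beta * \1_J x)%R%:E * nu A <= P x A.
Variables (Pr : probability Om R) (Xs : nat -> Om -> T) (G : nat -> Om -> bool).
Hypothesis Hsplit : is_split_chain Pr Xs G P beta J nu.
Hypothesis Hirr : pi_irreducible pi P.
Hypothesis Hstat : forall A, measurable A -> \int[pi]_x P x A = pi A.
Hypothesis piJ : 0 < pi J.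

Let mX n : measurable_fun setT (Xs n). Proof. by case: Hsplit. Qed.
Let mG n : measurable [set w | G n w]. Proof. by case: Hsplit. Qed.

Let b x := (beta * \1_J x)%R.

Let b_ge0 x : (0 <= b x)%R. Proof. exact: minor_weight_ge0. Qed.
Let b_le1 x : (b x <= 1)%R. Proof. exact: minor_weight_le1 Hminor x. Qed.
Let mb : measurable_fun setT (fun x => (b x)%:E).
Proof. exact: measurable_minor_weight. Qed.

(** The residual kernel before normalisation, which remains meaningful where [b x = 1]. *)
Definition residual (A : set T) (x : T) : \bar R := P x A - (b x)%:E * nu A.

Lemma residual_ge0 A x : measurable A -> 0 <= residual A x.
Proof.
by move=> mA; rewrite /residual sube_ge0 ?Hminor// fin_numM ?fin_num_measure.
Qed.

Lemma residualD A x : measurable A -> residual A x + (b x)%:E * nu A = P x A.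
Proof.
by move=> mA; rewrite /residual subeK// fin_numM ?fin_num_measure.
Qed.

Lemma measurable_residual A : measurable A -> measurable_fun setT (residual A).
Proof.
move=> mA; apply: emeasurable_funB; first exact: measurable_kernel.
by apply: emeasurable_funM => //; exact: mb.
Qed.

Lemma residual_Qres A x : measurable A ->
  residual A x = (1 - b x)%:E * Qres P beta J nu x A.
Proof.
move=> mA; rewrite /Qres -/(b x) -/(residual A x).
have [b1|b1] := eqVneq (b x) 1%R; last first.
  by rewrite muleCA -EFinM divff ?mule1// subr_eq0 eq_sym.
(* [1 - b x = 0]: the junk value [0^-1 = 0] is harmless since the residual mass is 0 *)
rewrite b1 subrr mul0e.
have r0 : residual setT x = 0.
  by rewrite /residual prob_kernel probability_setT b1 mule1 subee.
have rD : residual A x + residual (~` A) x = residual setT x.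
  have mCA : measurable (~` A) by exact: measurableC.
  rewrite /residual b1 !mul1e -(setUv A) !measureU ?setICr//.
  by rewrite addeACA fin_num_oppeD ?fin_num_measure.
apply/eqP; rewrite eq_le residual_ge0// andbT -r0 -rD leeDl// residual_ge0//.
exact: measurableC.
Qed.

(** The event that the first cycle is longer than [i]. *)
Definition alive (i : nat) : set Om := cyl Xs G i (fun=> setT) (fun=> [set false]).

Lemma measurable_alive i : measurable (alive i).
Proof. by rewrite /alive cylE; apply: measurable_traj_cylinder. Qed.

Definition cycle_law (i : nat) : {measure set T -> \bar R} :=
  law_on Pr (measurable_alive i) (mX i).

Lemma cycle_lawE i A : cycle_law i A = Pr (alive i `&` Xs i @^-1` A).
Proof. by rewrite setIC. Qed.

Lemma cycle_law0 A : measurable A -> cycle_law 0 A = nu A.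
Proof.
move=> mA; rewrite cycle_lawE; case: Hsplit => _ _ H0 _ _; rewrite -H0//.
by congr (Pr _); apply/seteqP; split=> w // [].
Qed.

Let aliveS i : alive i.+1 = alive i `&` [set w | ~~ G i w].
Proof.
apply/seteqP; split=> w /=.
  move=> H; split; first by move=> j ji; apply: H; exact: ltnW.
  by have [_] := H i (ltnSn i); rewrite /= => ->.
move=> [H1 H2] j; rewrite ltnS leq_eqVlt => /predU1P[->|]; last exact: H1.
by split=> //; exact/negbTE.
Qed.

Let integral_minor_weight D i : measurable D ->
  \int[Pr]_(w in D) (b (Xs i w))%:E = beta%:E * Pr (D `&` Xs i @^-1` J).
Proof.
move=> mD; have mXJ : measurable (Xs i @^-1` J).
  by rewrite -[X in measurable X]setTI; exact: mX.
under eq_integral => w _.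
  rewrite /b EFinM (_ : \1_J (Xs i w) = \1_(Xs i @^-1` J) w); last first.
    by rewrite !indicE; congr (_%:R); apply/idP/idP => /set_mem H; apply: mem_set.
  over.
rewrite ge0_integralZl_EFin ?(ltW beta_gt0)//.
- by rewrite integral_indic// setIC.
- by apply/measurable_EFinP; exact: measurable_indic.
Qed.

Let PrG i C : measurable C ->
  Pr (alive i `&` [set w | C (Xs i w) /\ G i w]) = beta%:E * cycle_law i (C `&` J).
Proof.
move=> mC; have mXC : measurable (Xs i @^-1` C).
  by rewrite -[X in measurable X]setTI; exact: mX.
case: Hsplit => _ _ _ HG _; rewrite HG//.
rewrite (integral_minor_weight i); last first.
  by apply: measurableI => //; exact: measurable_alive.
by rewrite cycle_lawE preimage_setI setIA.
Qed.

(** Surviving step [i] has conditional probability [1 - b x], and the next state is then drawn from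
    [Qres]; the product is [residual]. The integral is split over [J] and its complement because [b]
    is constant on each. *)
Lemma cycle_lawS i A : measurable A -> cycle_law i.+1 A = \int[cycle_law i]_x residual A x.
Proof.
move=> mA; rewrite cycle_lawE; case: (Hsplit) => _ _ _ _ HX; rewrite HX//.
rewrite -/(alive i.+1).
have mXp C : measurable C -> measurable (Xs i @^-1` C).
  by move=> mC; rewrite -[X in measurable X]setTI; exact: mX.
have malive := measurable_alive.
have mCJ : measurable (~` J) by exact: measurableC.
pose q x := Qres P beta J nu x A.
have q0 x : 0 <= q x by exact: Qres_ge0.
have mq : measurable_fun setT q by exact: measurable_Qres.
rewrite (eq_integral (fun w => q (Xs i w))); last first.
  by move=> w /set_mem; rewrite aliveS => -[_ /negbTE]/= ->.
rewrite [RHS]ge0_integral_law_on//; [|exact: measurable_residual|by move=> x; exact: residual_ge0].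
have mqX : measurable_fun setT (fun w => q (Xs i w)) by exact: measurableT_comp.
have mrX : measurable_fun setT (fun w => residual A (Xs i w)).
  by apply: (measurableT_comp (measurable_residual mA)).
have spl D (f : Om -> \bar R) : measurable D -> measurable_fun setT f ->
    (forall w, 0 <= f w) ->
    \int[Pr]_(w in D) f w = \int[Pr]_(w in D `&` Xs i @^-1` J) f w +
      \int[Pr]_(w in D `&` Xs i @^-1` (~` J)) f w.
  move=> mD mf f0; rewrite -ge0_integral_setU//.
  - by rewrite -setIUr -preimage_setU setUv preimage_setT setIT.
  - by apply: measurableI => //; exact: mXp.
  - by apply: measurableI => //; exact: mXp.
  - exact: measurable_funTS.
  - by apply/disj_setPS => w [[_ /= Jw] [_]].
have beta1 : J !=set0 -> (beta <= 1)%R.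
  by move=> [x Jx]; have := b_le1 x; rewrite /b indicE mem_set// mulr1.
rewrite spl// [RHS]spl//; last by move=> w; exact: residual_ge0.
have PrN C : measurable C -> Pr (alive i.+1 `&` Xs i @^-1` C) =
    cycle_law i C - beta%:E * cycle_law i (C `&` J).
  move=> mC; rewrite -PrG// cycle_lawE -(Pr_GammaN Hsplit)//.
  by rewrite aliveS; congr (Pr _); apply/seteqP; split=> w /= [] => [[]|? []].
have lamfin C : measurable C -> cycle_law i C \is a fin_num.
  move=> mC; rewrite cycle_lawE fin_num_measure//; apply: measurableI => //; exact: mXp.
congr (_ + _).
- have [J0|/set0P Jn0] := eqVneq J set0.
    by rewrite J0 preimage_set0 !setI0 !integral_set0.
  rewrite (@ge0_integral_eq_law _ _ _ Om Om T R Pr Pr (alive i.+1 `&` Xs i @^-1` J)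
    (alive i `&` Xs i @^-1` J) (Xs i) (Xs i) (1 - beta) q)//.
  + rewrite -ge0_integralZl_EFin//.
    * apply: eq_integral => w /set_mem[_ Jw].
      by rewrite residual_Qres// /b indicE mem_set// mulr1.
    * by apply: measurableI => //; exact: mXp.
    * exact: measurable_funTS.
    * by rewrite subr_ge0 beta1.
  + by apply: measurableI => //; exact: mXp.
  + by apply: measurableI => //; exact: mXp.
  + by rewrite subr_ge0 beta1.
  + move=> C mC; have mJC := measurableI _ _ mJ mC.
    rewrite -!setIA; apply: (eq_trans (PrN _ mJC)).
    transitivity ((1 - beta)%:E * cycle_law i (J `&` C)); last by rewrite cycle_lawE.
    by rewrite setIAC setIid EFinB muleBl ?mul1e// lamfin.
- rewrite -[RHS]mul1e.
  rewrite (@ge0_integral_eq_law _ _ _ Om Om T R Pr Pr (alive i.+1 `&` Xs i @^-1` (~` J))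
    (alive i `&` Xs i @^-1` (~` J)) (Xs i) (Xs i) 1 q)//.
  + congr (_ * _); apply: eq_integral => w /set_mem[_ Jw].
    by rewrite residual_Qres// /b indicE memNset// mulr0 subr0 mul1e.
  + by apply: measurableI => //; exact: mXp.
  + by apply: measurableI => //; exact: mXp.
  + move=> C mC; have mJC := measurableI _ _ mCJ mC.
    rewrite -!setIA; apply: (eq_trans (PrN _ mJC)).
    transitivity (1 * cycle_law i (~` J `&` C)); last by rewrite cycle_lawE.
    by rewrite mul1e setIAC setICl set0I measure0 mule0 sube0.
Qed.

Lemma integral_kernel_residual (m : {measure set T -> \bar R}) A : measurable A ->
  \int[m]_x P x A = \int[m]_x residual A x + beta%:E * m J * nu A.
Proof.
move=> mA.
under eq_integral => x _ do rewrite -(residualD x mA).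
rewrite ge0_integralD//; last 4 first.
- by move=> x _; exact: residual_ge0.
- exact: measurable_residual.
- by move=> x _; rewrite mule_ge0// lee_fin b_ge0.
- by apply: emeasurable_funM => //; exact: mb.
congr (_ + _); rewrite ge0_integralZr//; last by move=> x _; rewrite lee_fin b_ge0.
congr (_ * _).
under eq_integral => x _ do rewrite /b EFinM.
rewrite ge0_integralZl_EFin ?(ltW beta_gt0)//.
- by rewrite integral_indic// setIT.
- by apply/measurable_EFinP; exact: measurable_indic.
Qed.

(** By [kac] at [phi = 1], this turns out to be the inverse of the mean cycle length. *)
Let c : R := (beta * fine (pi J))%R.

Let cE : c%:E = beta%:E * pi J.
Proof. by rewrite EFinM fineK// fin_num_measure. Qed.

Let c_gt0 : (0 < c)%R.
Proof. by rewrite -lte_fin cE mule_gt0. Qed.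

Let c_ge0 : (0 <= c)%R. Proof. exact: ltW. Qed.

(** The occupation measure of the first cycle. *)
Let Lam : {measure set T -> \bar R} := mseries cycle_law 0.

Let LamE A : Lam A = \sum_(0 <= k <oo) cycle_law k A.
Proof. by []. Qed.

(** Stationarity decomposes [pi] as [c * nu] plus the image of [pi] under [residual], while the
    partial sum of length [N.+1] is [nu] plus the image of that of length [N]; induction compares
    the two. *)
Lemma msum_cycle_law_le N A : measurable A -> c%:E * msum cycle_law N A <= pi A.
Proof.
elim: N A => [|N IH] A mA; first by rewrite /msum big_ord0 mule0.
rewrite /msum big_ord_recl/= ge0_muleDr//; last by apply: sume_ge0.
rewrite -(Hstat mA) integral_kernel_residual// -cE [leRHS]addeC cycle_law0// leeD2l//.
rewrite (eq_bigr (fun k : 'I_N => \int[cycle_law k]_x residual A x)); last first.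
  by move=> k _; rewrite cycle_lawS.
have r0 x : 0 <= residual A x by exact: residual_ge0.
have mr := measurable_residual mA.
rewrite -(ge0_integral_measure_sum cycle_law measurableT (fun x _ => r0 x) mr).
rewrite -[c]/((NngNum c_ge0)%:num) -ge0_integral_mscale//.
apply: ge0_le_measure_integral => //.
Qed.

Lemma Lam_le A : measurable A -> c%:E * Lam A <= pi A.
Proof.
move=> mA; rewrite LamE -nneseriesZl//.
apply: lime_le.
  by apply: is_cvg_nneseries => k _ _; rewrite mule_ge0.
apply: nearW => N; rewrite -ge0_sume_distrr// big_mkord.
exact: msum_cycle_law_le.
Qed.

Lemma Lam_residual A : measurable A -> Lam A = nu A + \int[Lam]_x residual A x.
Proof.
move=> mA.
have r0 x : 0 <= residual A x by exact: residual_ge0.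
rewrite LamE nneseries_recl// cycle_law0//; congr (_ + _).
rewrite -nneseries_addn// /Lam ge0_integral_measure_series//; last exact: measurable_residual.
by apply: eq_eseriesr => i _; rewrite addn1 cycle_lawS.
Qed.

Hypothesis tau_fin : Pr [set w | first_renewal (G^~ w) 1 = None] = 0.

Let alive_first i w t : first_renewal (G^~ w) 1 = Some t ->
  (alive i w <-> (i < t)%N).
Proof.
move=> /first_renewalP[t0 rt tmin]; case: t => // t in t0 rt tmin *.
split=> [al|it].
  rewrite ltnS leqNgt; apply/negP => ti.
  by have [_ /=] := al t ti; move: rt; rewrite /renewal/= => ->.
move=> j ji; split => //=; have := tmin j.+1.
rewrite /renewal/= => H; apply/negbTE/H.
by rewrite ltnS; exact: leq_trans ji _.
Qed.

Let renew_alive i : [set w | first_renewal (G^~ w) 1 = Some i.+1] =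
  alive i `&` [set w | setT (Xs i w) /\ G i w].
Proof.
apply/seteqP; split=> w.
  move=> E; split; first by apply/(alive_first i E).
  by split=> //; move: (E); rewrite /mkset => /first_renewalP[_].
move=> [al [_ Gi]]; rewrite /mkset; apply/first_renewalP; split=> //.
by case=> // j /= ji; have [_ /= ] := al j ji; rewrite /renewal/= => ->.
Qed.

Let mfr i : measurable [set w | first_renewal (G^~ w) 1 = Some i.+1].
Proof.
rewrite renew_alive; apply: measurableI; first exact: measurable_alive.
rewrite (_ : [set w | _] = [set w | G i w])//.
by apply/seteqP; split=> w // [].
Qed.

(** [beta * cycle_law i J] is the probability that the cycle ends exactly at [i.+1], and by
    [tau_fin] the cycle ends almost surely. *)
Lemma Lam_J : beta%:E * Lam J = 1.
Proof.
rewrite LamE -nneseriesZl//.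
rewrite (eq_eseriesr (g := fun i =>
    Pr [set w | first_renewal (G^~ w) 1 = Some i.+1])); last first.
  by move=> i _; rewrite renew_alive PrG// setTI.
rewrite -(measure_semi_bigcup Pr)//; first last.
- exact: bigcup_measurable.
- apply/trivIsetP => i j _ _ ij; apply/seteqP; split=> // w [/= -> []] eij.
  by rewrite eij eqxx in ij.
set U := \bigcup_n _.
have mU : measurable U by exact: bigcup_measurable.
have UC : ~` U = [set w | first_renewal (G^~ w) 1 = None].
  apply/seteqP; split=> w; rewrite /setC /mkset; last first.
    by move=> E [t _]; rewrite /mkset E.
  move=> nU; case E : (first_renewal (G^~ w) 1) => [[|t]|//].
    by move/first_renewalP : E => [].
  by exfalso; apply: nU; exists t.
have Ufin : Pr U \is a fin_num by exact: fin_num_measure.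
have := probability_setC Pr mU; rewrite UC tau_fin -(fineK Ufin) -EFinB.
move=> [/eqP]; rewrite eq_sym subr_eq0 => /eqP U1.
by apply: (eq_trans (esym (fineK Ufin))); rewrite -U1.
Qed.

(** By [Lam_J] the regenerating part of [P] returns exactly one copy of [nu], the law that starts
    the cycle. *)
Lemma Lam_invariant A : measurable A -> \int[Lam]_x P x A = Lam A.
Proof.
by move=> mA; rewrite integral_kernel_residual// Lam_J mul1e addeC -Lam_residual.
Qed.

(** The states from which [J] is reached in exactly [k] steps with positive
    probability. *)
Fixpoint reach (k : nat) : set T :=
  if k is k'.+1 then [set x | 0 < P x (reach k')] else J.

Lemma measurable_reach k : measurable (reach k).
Proof.
elim: k => [//|k IH] /=.
rewrite (_ : [set x | _] = setT `&` [set x | 0 < P x (reach k)]); last by rewrite setTI.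
by apply: emeasurable_fun_o_infty => //; exact: measurable_kernel.
Qed.

Lemma kiter_ge0 n x : 0 <= kiter P n x J.
Proof. by elim: n x => [//|n IH] x /=; apply: integral_ge0. Qed.

Lemma measurable_kiter n : measurable_fun setT (fun x => kiter P n x J).
Proof.
elim: n => [|n IH] /=.
  by under eq_fun do rewrite diracE; apply/measurable_EFinP; exact: measurable_indic.
apply: measurable_fun_integral_kernel => //.
- by move=> U mU; exact: measurable_kernel.
- exact: kiter_ge0.
Qed.

(** If [P x] did not charge [reach n], the integrand defining the next iterate would vanish off a
    null set. *)
Lemma kiter_reach n x : 0 < kiter P n x J -> reach n x.
Proof.
elim: n x => [|n IH] x /=.
  by rewrite diracE; case: (boolP (x \in J)) => [/set_mem//|_]; rewrite ltxx.
apply: contraPP => /negP; rewrite -leNgt => Px0.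
have {}Px0 : P x (reach n) = 0 by apply/eqP; rewrite eq_le Px0/=.
apply/negP; rewrite -leNgt.
rewrite (ge0_negligible_integral (N := reach n))//.
- rewrite integral0_eq// => y [_ ny].
  apply/eqP; rewrite eq_le kiter_ge0 andbT leNgt; apply/negP => /IH; exact: ny.
- exact: measurable_reach.
- exact: measurable_kiter.
- by move=> y _; exact: kiter_ge0.
Qed.

Lemma pi_Lam A : measurable A -> pi A = c%:E * Lam A.
Proof.
pose mu := mscale (NngNum c_ge0) Lam.
have muE B : mu B = c%:E * Lam B by [].
have [rho rhoE'] := @measure_diff _ _ _ mu pi Lam_le.
have rhoE C : measurable C -> pi C = mu C + rho C by exact: rhoE'.
have mufin B : measurable B -> mu B \is a fin_num.
  move=> mB; rewrite ge0_fin_numE//; apply: (le_lt_trans (Lam_le mB)).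
  by rewrite ltey_eq fin_num_measure.
(* Both [pi] and [mu] are invariant, and the finite mass [mu B] can be cancelled. *)
have rho_inv B : measurable B -> \int[rho]_x P x B = rho B.
  move=> mB; have mP : measurable_fun setT (fun x => P x B) by exact: measurable_kernel.
  have E : \int[pi]_x P x B = \int[measure_add mu rho]_x P x B.
    apply: eq_measure_integral => C mC _.
    by apply: (eq_trans (rhoE _ mC)); exact/esym/measure_addE.
  have := Hstat mB; rewrite E.
  rewrite ge0_integral_measure_add// ge0_integral_mscale// Lam_invariant// rhoE// muE.
  by apply: adde_fin_inj; rewrite -muE mufin.
(* Here [c * Lam J = pi J * (beta * Lam J) = pi J]. *)
have rhoJ : rho J = 0.
  have := rhoE _ mJ; rewrite muE cE muleAC Lam_J mul1e.
  rewrite -[X in X = _]adde0 => /adde_fin_inj <-//.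
  exact: fin_num_measure.
(* Invariance gives that [P x (reach k)] has [rho]-integral [rho (reach k) = 0], so it vanishes
   almost everywhere and [reach k.+1] is null. *)
have rho_reach k : rho (reach k) = 0.
  elim: k => [//|k IH].
  have mk := measurable_reach k.
  have mP : measurable_fun setT (fun x => P x (reach k)) by exact: measurable_kernel.
  have : \int[rho]_x `|P x (reach k)| = 0.
    by under eq_integral do rewrite gee0_abs//; rewrite rho_inv.
  move=> /(ae_eq_integral_abs _ measurableT mP) [N [mN N0 subN]].
  apply/eqP; rewrite eq_le measure_ge0 andbT -N0 le_measure ?inE//.
    exact: measurable_reach.
  move=> x /= Px; apply: subN => /= /(_ I) Px0.
  by rewrite Px0 ltxx in Px.
move=> mA; rewrite rhoE// (_ : rho A = 0) ?adde0//.
have : rho.-negligible (\bigcup_k reach k).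
  apply: negligible_bigcup => k; apply/(negligibleP rho (measurable_reach k)).
  exact: rho_reach.
have -> : \bigcup_k reach k = setT.
  apply/seteqP; split=> // x _; have [n xn] := Hirr mJ piJ x.
  by exists n.+1 => //; exact: kiter_reach.
move=> /(negligibleP rho measurableT) rT.
by apply/eqP; rewrite eq_le measure_ge0 andbT -rT le_measure ?inE.
Qed.

Lemma measurable_Xi1 (phi : T -> R) : measurable_fun setT phi ->
  measurable_fun setT (Xi1 phi Xs G).
Proof.
move=> mphi.
apply: (measurable_fun_option (h := fun w => first_renewal (G^~ w) 1)
  (F := fun o w => if o is Some t then (\sum_(i < t) phi (Xs i w))%R else 0%R)).
  case=> [|s]; last exact: mfr.
  rewrite (_ : [set w | _] = set0)//; apply/seteqP; split=> w //.
  by rewrite /mkset => /first_renewalP[].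
by case=> [t|//]; apply: measurable_sum => i; exact: (measurableT_comp mphi).
Qed.

(** After replacing [pi] by [c * Lam], Tonelli exchanges the sum over [i] with the expectation, and
    summing [phi (Xs i w)] over the times at which [w] is [alive] gives the block sum. *)
Lemma kac (phi : T -> R) : measurable_fun setT phi -> (forall x, 0 <= phi x)%R ->
  \int[pi]_x (phi x)%:E = c%:E * \int[Pr]_w (Xi1 phi Xs G w)%:E.
Proof.
move=> mphi phi0.
have mphiE : measurable_fun setT (EFin \o phi) by exact/measurable_EFinP.
rewrite (@eq_measure_integral _ _ _ _ (mscale (NngNum c_ge0) Lam)); last first.
  by move=> A mA _; exact: pi_Lam.
rewrite ge0_integral_mscale//; last by move=> x _; rewrite lee_fin.
congr (_ * _).
rewrite /Lam ge0_integral_measure_series//; last by move=> x _; rewrite lee_fin.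
pose F i w := ((fun w => (phi (Xs i w))%:E) \_ (alive i)) w.
have mF i : measurable_fun setT (F i).
  apply/(measurable_restrictT _ (measurable_alive i)).
  by apply: measurable_funTS; exact: (measurableT_comp mphiE (mX i)).
have F0 i w : 0 <= F i w by rewrite /F patchE; case: ifP => // _; rewrite lee_fin.
transitivity (\sum_(0 <= i <oo) \int[Pr]_w F i w).
  apply: eq_eseriesr => i _; rewrite ge0_integral_law_on//.
  by rewrite integral_mkcond.
rewrite -integral_nneseries//.
have mS : measurable_fun setT (fun w => \sum_(0 <= i <oo) F i w).
  exact: ge0_emeasurable_sum.
apply: ge0_ae_eq_integral => //.
- apply/measurable_EFinP; exact: measurable_Xi1.
- by move=> w _; exact: nneseries_ge0.
- move=> w _; rewrite lee_fin /Xi1; case: regen => // t.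
  exact: sumr_ge0.
(* Without a renewal [Xi1] takes its default value [0] while the series may be positive, so the two
   agree only almost everywhere. *)
exists [set w | first_renewal (G^~ w) 1 = None]; split => //.
  by apply: measurable_first_renewal_None => i; exact: measurable_funG.
move=> w; rewrite /setC /mkset; apply: contra_notP.
  case E : (first_renewal (G^~ w) 1) => [t|//] _ _.
  rewrite (nneseries_split _ t)//= add0n big_mkord.
  rewrite [X in _ + X]eseries0 ?adde0; last first.
    move=> i ti _; rewrite /F patchE memNset// => /(alive_first i E).
    by rewrite ltnNge ti.
  rewrite /Xi1 -[regen _ 1]/(first_renewal (G^~ w) 1) E -sumEFin.
  apply: eq_bigr => i _; rewrite /F patchE mem_set//.
  by apply/(alive_first i E).
Qed.

(** [kac] is applied to the positive part [p] and the negative part [q], whose integrals are finite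
    and equal; the factor [c > 0] then cancels. *)
Lemma Xi1_mean0 (phi : T -> R) : measurable_fun setT phi ->
  pi.-integrable setT (EFin \o phi) -> \int[pi]_x (phi x)%:E = 0 ->
  Pr.-integrable setT (EFin \o Xi1 phi Xs G) /\
  \int[Pr]_w (Xi1 phi Xs G w)%:E = 0.
Proof.
move=> mphi iphi phi_mean0.
pose p x := Num.max (phi x) 0%R; pose q x := Num.max (- phi x)%R 0%R.
have mp : measurable_fun setT p by exact: measurable_maxr.
have mq : measurable_fun setT q.
  by apply: measurable_maxr => //; exact: measurableT_comp.
have p0 x : (0 <= p x)%R by rewrite le_max lexx orbT.
have q0 x : (0 <= q x)%R by rewrite le_max lexx orbT.
have pqE x : phi x = (p x - q x)%R.
  by rewrite /p /q; case: (lerP (phi x) 0); case: (lerP (- phi x) 0); lra.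
have pE : \int[pi]_x (p x)%:E = \int[pi]_x ((EFin \o phi)^\+ x).
  by apply: eq_integral => x _; rewrite funeposE/= EFin_max.
have qE : \int[pi]_x (q x)%:E = \int[pi]_x ((EFin \o phi)^\- x).
  by apply: eq_integral => x _; rewrite funenegE/= EFin_max.
have pfin : \int[pi]_x (p x)%:E \is a fin_num.
  by rewrite pE; apply: integrable_fin_num => //; exact: integrable_funepos.
have qfin : \int[pi]_x (q x)%:E \is a fin_num.
  by rewrite qE; apply: integrable_fin_num => //; exact: integrable_funeneg.
have pq : \int[pi]_x (p x)%:E = \int[pi]_x (q x)%:E.
  have : \int[pi]_x (p x)%:E - \int[pi]_x (q x)%:E = 0.
    by rewrite pE qE -integralE.
  rewrite -(fineK pfin) -(fineK qfin) -EFinB => -[/eqP].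
  by rewrite subr_eq0 => /eqP ->.
have Xint (r : T -> R) : measurable_fun setT r -> (forall x, 0 <= r x)%R ->
    \int[pi]_x (r x)%:E \is a fin_num -> Pr.-integrable setT (EFin \o Xi1 r Xs G).
  move=> mr r0 rfin; apply/integrableP; split.
    by apply/measurable_EFinP; exact: measurable_Xi1.
  rewrite (eq_integral (fun w => (Xi1 r Xs G w)%:E)); last first.
    move=> w _; rewrite /= ger0_norm// /Xi1; case: regen => // t.
    exact: sumr_ge0.
  move: rfin; rewrite kac//; case: (\int[Pr]_w _) => [x||] //.
    by rewrite ltry.
  by rewrite mulry gtr0_sg// mul1e.
have XE w : (Xi1 phi Xs G w = Xi1 p Xs G w - Xi1 q Xs G w)%R.
  rewrite /Xi1; case: regen => [t|]; last by rewrite subrr.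
  by rewrite -sumrB; apply: eq_bigr => i _.
have ip := Xint _ mp p0 pfin; have iq := Xint _ mq q0 qfin.
have fE : EFin \o Xi1 phi Xs G = (EFin \o Xi1 p Xs G) \- (EFin \o Xi1 q Xs G).
  by apply/funext => w /=; rewrite XE EFinB.
split; first by rewrite fE; exact: integrableB.
rewrite (eq_integral (((EFin \o Xi1 p Xs G) \- (EFin \o Xi1 q Xs G)))); last first.
  by move=> w _; rewrite XE EFinB.
rewrite integralB//.
have : c%:E * \int[Pr]_w (Xi1 p Xs G w)%:E = c%:E * \int[Pr]_w (Xi1 q Xs G w)%:E.
  by rewrite -!kac.
have ipfin := integrable_fin_num measurableT ip.
have iqfin := integrable_fin_num measurableT iq.
rewrite /= in ipfin iqfin *.
rewrite -(fineK ipfin) -(fineK iqfin) -!EFinM -EFinB => -[].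
by move=> /mulfI -> //; rewrite ?subrr// gt_eqF.
Qed.

End kac.

(** * Mean-square error at the stopping time, and its expected length *)

Unset Implicit Arguments.

Theorem theorem3p1 (R : realType)
  (M : completePseudoMetricType R) (HM : polish_space M)
  (pi : probability (borel_type M) R)
  (P : R.-pker (borel_type M) ~> (borel_type M))
  (Hirr : pi_irreducible pi P)
  (Hstat : forall A, measurable A -> \int[pi]_x P x A = pi A)
  (J : set (borel_type M)) (mJ : measurable J) (piJ : 0 < pi J)
  (beta : R) (beta_gt0 : (0 < beta)%R)
  (nu : probability (borel_type M) R)
  (Hminor : forall x A, measurable A ->
     (beta * \1_J x)%R%:E * nu A <= P x A)
  (d' : measure_display) (Om : measurableType d') (Pr : probability Om R)
  (Xs : nat -> Om -> borel_type M) (G : nat -> Om -> bool)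
  (Hsplit : is_split_chain Pr Xs G P beta J nu)
  (f : borel_type M -> R) (mf : measurable_fun setT f)
  (intf : pi.-integrable setT (EFin \o f))
  (n : nat) (n_ge1 : (1 <= n)%N) :
  let theta := fine (\int[pi]_x (f x)%:E) in
  let fbar := fun x => (f x - theta)%R in
  let EXi2 := \int[Pr]_w ((Xi1 fbar Xs G w) ^+ 2)%:E in
  let Etau := \int[Pr]_w Tbar (G^~ w) 1 in
  let Etau2 := \int[Pr]_w (Tbar (G^~ w) 1) ^+ 2 in
  let ETR := \int[Pr]_w TRbar (G^~ w) n in
  EXi2 < +oo -> Etau2 < +oo ->
  let sigma2 := (fine EXi2 / fine Etau)%R in
  let n0 := (fine Etau2 / fine Etau - 1)%R in
  \int[Pr]_w ((theta_hat f Xs G n w - theta) ^+ 2)%:E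
    <= (sigma2 / n%:R ^+ 2)%R%:E * ETR
  /\ ETR <= (n%:R + n0)%R%:E.
Proof.
move=> theta fbar EXi2 Etau Etau2 ETR EXi2oo Etau2oo sigma2 n0.
have [mX mG _ _ _] := Hsplit.
have indep := regen_indep mJ beta_gt0 Hminor Hsplit.
have ETRE : ETR = \int[Pr]_w Nbar (G^~ w) n.
  by apply: eq_integral => w _; rewrite /TRbar /Nbar TR_first_renewal.
have Etau_lty : Etau < +oo by exact: (integral_Nbar1_lty mG Etau2oo).
have Etau_ge1 : 1 <= Etau by exact: integral_Nbar1_ge1.
split; last by rewrite ETRE; exact: (lorden mX mG indep).
have tau_fin : Pr [set w | first_renewal (G^~ w) 1 = None] = 0.
  exact: (first_renewal_None_null mX mG indep).
have mfbar : measurable_fun setT fbar by exact: measurable_funB.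
have theta_fin : \int[pi]_x (f x)%:E \is a fin_num by exact: integrable_fin_num.
have int_cst : pi.-integrable setT (fun=> theta%:E).
  exact: finite_measure_integrable_cst.
have int_fbar : pi.-integrable setT (EFin \o fbar).
  rewrite (_ : EFin \o fbar = (EFin \o f) \- (fun=> theta%:E)); first exact: integrableB.
  by apply/funext => x /=; rewrite EFinB.
have fbar_mean0 : \int[pi]_x (fbar x)%:E = 0.
  rewrite (eq_integral ((EFin \o f) \- (fun=> theta%:E))); last first.
    by move=> x _; rewrite EFinB.
  rewrite integralB// probability_integral_cst /theta fineK// subee//.
have [int_xi xi_mean0] := Xi1_mean0 mJ beta_gt0 Hminor Hsplit Hirr Hstat piJ
  tau_fin mfbar int_fbar fbar_mean0.
have W2 := integral_block_sum_sqr mX mG indep mfbar int_xi xi_mean0 EXi2oo n.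
have n_gt0 : (0 < n%:R :> R)%R by rewrite ltr0n.
have mW : measurable_fun setT (fun w => block_sum fbar n (traj Xs G 0 w)).
  exact: (measurableT_comp (measurable_block_sum mfbar n) (measurable_traj mX mG 0)).
have thetaE w : theta_hat f Xs G n w = (if first_renewal (G^~ w) n is Some t
    then (\sum_(i < t) f (Xs i w)) / t%:R else 0)%R.
  by rewrite /theta_hat TR_first_renewal.
have mtheta : measurable_fun setT (theta_hat f Xs G n).
  rewrite (funext thetaE).
  apply: (measurable_fun_option (h := fun w => first_renewal (G^~ w) n)
    (F := fun o w =>
      if o is Some t then ((\sum_(i < t) f (Xs i w)) / t%:R)%R else 0%R)).
    by move=> s; apply: measurable_first_renewal => i _; exact: measurable_funG.
  case=> [t|//]; apply: measurable_funM => //.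
  by apply: measurable_sum => i; exact: (measurableT_comp mf).
(* The error equals [W_n] divided by [T_(R(n))], and [T_(R(n)) >= n]. *)
apply: (@le_trans _ _ (\int[Pr]_w ((n%:R ^- 2)%:E *
    ((block_sum fbar n (traj Xs G 0 w)) ^+ 2)%:E))).
  apply: ae_ge0_le_integral => //.
  - by move=> w _; rewrite lee_fin sqr_ge0.
  - apply/measurable_EFinP; apply: measurable_funX.
    exact: measurable_funB.
  - by move=> w _; rewrite -EFinM lee_fin mulr_ge0 ?sqr_ge0// invr_ge0 sqr_ge0.
  - apply: measurable_funeM; apply/measurable_EFinP; exact: measurable_funX.
  (* With no renewal left, both [theta_hat] and [block_sum] default to [0] and the comparison would
     read [theta ^+ 2 <= 0]; this event is null. *)
  exists [set w | first_renewal (G^~ w) n = None]; split => //.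
  - by apply: measurable_first_renewal_None => i; exact: measurable_funG.
  - exact: (first_renewal_None_null mX mG indep).
  move=> w; rewrite /setC /mkset; apply: contra_notP.
  case E : (first_renewal (G^~ w) n) => [t|//] _ _.
  have [nt _ _] := (first_renewalP _ _ _).1 E.
  have t_gt0 : (0 < t%:R :> R)%R by rewrite ltr0n (leq_trans n_ge1 nt).
  rewrite thetaE E /block_sum [first_renewal _ _](E : first_renewal _ _ = _).
  rewrite -EFinM lee_fin.
  have -> : ((\sum_(i < t) f (Xs i w)) / t%:R - theta =
      (\sum_(i < t) fbar (traj Xs G 0 w i).1) / t%:R)%R.
    rewrite /fbar sumrB sumr_const card_ord mulrBl; congr (_ - _)%R.
    by rewrite -[(theta *+ t)%R]mulr_natr mulfK// gt_eqF.
  rewrite exprMn mulrC exprVn ler_wpM2r ?sqr_ge0//.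
  by rewrite lef_pV2 ?posrE ?exprn_gt0// lerXn2r ?nnegrE ?ler_nat.
rewrite ge0_integralZl_EFin//; last 2 first.
- by move=> w _; rewrite lee_fin sqr_ge0.
- by apply/measurable_EFinP; exact: measurable_funX.
apply: (@le_trans _ _ ((n%:R ^- 2)%:E *
    ((\sum_(k < n) Pr [set w | renewal (G^~ w) k]) * EXi2))).
  by apply: lee_wpmul2l => //; rewrite lee_fin invr_ge0 sqr_ge0.
(* [E T_(R(n))] is [U * Etau], so the denominator of [sigma2] cancels and the two sides are
   equal. *)
rewrite ETRE (integral_Nbar mX mG indep).
set U := \sum_(k < n) _.
have Ufin : U \is a fin_num.
  apply/sum_fin_numP => k _ _; apply: fin_num_measure.
  by apply: measurable_renewal => i _; exact: measurable_funG.
have EXi2fin : EXi2 \is a fin_num.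
  by rewrite ge0_fin_numE//; apply: integral_ge0 => w _; rewrite lee_fin sqr_ge0.
have Etaufin : Etau \is a fin_num by rewrite ge0_fin_numE// (le_trans _ Etau_ge1).
have Etau_gt0 : (0 < fine Etau)%R by rewrite fine_gt0// (lt_le_trans _ Etau_ge1)/=.
rewrite -/Etau -(fineK Ufin) -(fineK EXi2fin) -(fineK Etaufin) -!EFinM lee_fin.
rewrite le_eqVlt; apply/orP; left; apply/eqP; rewrite /sigma2.
by field; rewrite !gt_eqF.
Qed.
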